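(* For any bounded function $a:\mathbb{N}\cup\{0\}\to\mathbb{C}$, $$\frac1N\sum_{\substack{n\le N\\ n\ \text{squarefree}}}a(\Omega(n))=\frac1N\sum_{\substack{n\le N\\ n\ \text{squarefree}}}a(\Omega(n)+1)+o_{N\to\infty}(1).$$ Moreover, for any integer $k\ge2$, $$\frac1{N^{1/k}}\sum_{\substack{n\le N\\ n\text{ is }k\text{-full}}}a(\Omega(n))=\frac1{N^{1/k}}\sum_{\substack{n\le N\\ n\text{ is }k\text{-full}}}a(\Omega(n)+k)+o_{N\to\infty}(1).$$
   Context: $\mathbb{N}=\{1,2,3,\dots\}$; sums are over positive integers $n$. $\Omega(n)$ is the number of prime divisors of $n$ counted with multiplicity ($\Omega(1)=0$). A natural number $n$ is squarefree if no prime square divides it, and $k$-full if $p^k\mid n$ for every prime factor $p$ of $n$; $1$ is both. $o_{N\to\infty}(1)$ denotes a quantity tending to $0$ as $N\to\infty$ (for fixed $a$ and $k$). *)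

(* Defs.v *)
From mathcomp Require Import all_boot all_order all_algebra.
From mathcomp Require Import all_classical all_reals all_analysis.
From mathcomp Require Import complex.

Set Implicit Arguments.
Unset Strict Implicit.
Unset Printing Implicit Defensive.

Definition Omega (n : nat) : nat := (\sum_(p <- primes n) logn p n)%N.

Definition squarefree (n : nat) : Prop :=
  forall p : nat, prime p -> ~~ (p ^ 2 %| n)%N.

Definition kfull (k n : nat) : Prop :=
  forall p : nat, prime p -> (p %| n)%N -> (p ^ k %| n)%N.

(* Main.v *)
Require Import Defs.
From mathcomp Require Import all_boot all_order all_algebra.
From mathcomp Require Import all_classical all_reals all_analysis.
From mathcomp Require Import complex.
From mathcomp Require Import zify ring lra.
Import Order.TTheory GRing.Theory Num.Theory.
Import numFieldNormedType.Exports.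
Local Open Scope classical_set_scope.
Local Open Scope complex_scope.
Local Open Scope ring_scope.

(** The statement for the squarefree numbers contains the prime number theorem
(take [a m = (-1)^m]), but it has an elementary proof. Fix a weight [w] on the
naturals with values in [0, 1] and [w (p * m) = w m] for primes [p] that do not
divide [m], and let [M_i(x)] be the mean over [n <= x] of
[w n * a (Omega n + i)].

The Turan-Kubilius variance bound says that most [n <= N] have about
[L = sum_(p in P) 1/p] prime divisors in a given finite set [P] of primes.
Weighting the mean by that number of divisors and writing [n = p * m] gives
[L * M_i(N) ~ sum_(p in P) M_(i+1)(N/p) / p] for every [P]. With [P] the set of
primes at which [M_(i+1)(N/p)] differs from [M_i(N)] by more than [kappa], this
bounds [sum_(p in P) 1/p] by a constant depending only on [kappa]
([exceptional_primes]): outside a set of primes of bounded mass, passing from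
[N] to [N/p] moves the index by one and leaves the mean alone.

Iterating over non-exceptional primes, [M_j(N/P) ~ M_0(N)] for many products [P]
of [j] primes, and [M_(j+1)(N/P) ~ M_1(N)] likewise. If a product of [j + 1]
primes and a product of [j] primes, taken from these two families, are close on
a logarithmic scale then, the means being slowly varying, both [M_0(N)] and
[M_1(N)] are close to the same [M_(j+1)(N/P)].

To make such products meet, one uses pairs of non-exceptional primes [p < q]
whose ratio lies between [1 + 1/t] and [1 + 1/e] ([narrow_pairs_exist]).
Replacing [p] by [q] in one factor after the other produces a staircase of
products with small steps whose total height is at least a factor 16
([staircase]); one more prime from a window of ratio 16 then brings some step
just below a prescribed power of 16. Almost all powers of 16, in the sense of
the harmonic measure, are reached in this way ([most_scales_hit]), so two such
families reach a common one ([wmean_shift_invariant]). Of the distribution of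
primes this uses only Chebyshev's lower bound on dyadic windows and the fact that
short intervals cannot contain too many primes, both read off from binomial
coefficients.

The weight [1_squarefree] gives the first assertion. For the second, every
[k]-full number is uniquely [m^k * b] with [b] a [k]-full number none of whose
exponents equals [k] or exceeds [2k - 1] ([kfull_core]); since the sum of
[b^(-1/k)] over those [b] converges, dominated convergence reduces the claim to
the weight [1] applied to [j |-> a (k * j + Omega b)]
([kfull_shift_invariant]). Complex sequences are split into real and imaginary
parts. *)

(** * Binomial coefficients and the distribution of primes *)

Lemma prod_primes_dvd (s : seq nat) (n : nat) :
  uniq s -> all prime s -> (forall p, p \in s -> (p %| n)%N) ->
  (\prod_(p <- s) p %| n)%N.
Proof.
elim: s => [|p s IH] /=; first by rewrite big_nil dvd1n.
case/andP=> ps us /andP[pp pr] dv; rewrite big_cons Gauss_dvd; last first.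
  rewrite big_seq; apply: (big_ind (fun x => coprime p x)).
  - exact: coprimen1.
  - by move=> x y cx cy; rewrite coprimeMr cx.
  move=> q qs; have pq := allP pr _ qs.
  rewrite prime_coprime // dvdn_prime2 //.
  by apply: contraNneq ps => ->.
rewrite dv ?mem_head //=; apply: IH => // q qs; apply: dv.
by rewrite inE qs orbT.
Qed.

Lemma prime_dvd_fact (p n : nat) : prime p -> (p %| n`!)%N -> (p <= n)%N.
Proof.
move=> pp; elim: n => [|n IH]; first by rewrite fact0 dvdn1; case: eqP pp => // ->.
rewrite factS Euclid_dvdM // => /orP[/dvdn_leq -> //|/IH]; lia.
Qed.

(** Primes in [(m, m + h]] divide the numerator [(m + h)!] of the binomial coefficient
but neither [m!] nor [h!]. *)
Lemma prod_primes_dvd_bin (m h : nat) : (h <= m)%N ->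
  (\prod_(m.+1 <= p < (m + h).+1 | prime p) p %| 'C(m + h, h))%N.
Proof.
move=> hm; rewrite -big_filter; apply: prod_primes_dvd.
- by rewrite filter_uniq // iota_uniq.
- exact: filter_all.
move=> p; rewrite mem_filter mem_index_iota => /andP[pp /andP[mp pm]].
have := bin_fact (leq_addl m h); rewrite addnK => e.
have : (p %| (m + h)`!)%N by apply: dvdn_fact; rewrite prime_gt0.
rewrite -e !Euclid_dvdM // => /or3P[//|/prime_dvd_fact|/prime_dvd_fact];
  move=> /(_ pp); lia.
Qed.

Lemma bin_leq_exp2 (n k : nat) : ('C(n, k) <= 2 ^ n)%N.
Proof.
elim: n k => [|n IH] [|k] //=; first by rewrite bin0 expn_gt0.
by rewrite binS expnS mul2n -addnn leq_add.
Qed.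

Lemma exp2_leq_central_bin (m : nat) : (2 ^ m <= 'C(m.*2, m))%N.
Proof.
elim: m => [|m IH] //; rewrite doubleS binS expnS mul2n -addnn leq_add //.
  by apply: leq_trans IH _; rewrite binS leq_addl.
by apply: leq_trans IH _; apply: leq_bin2l.
Qed.

(** By doubling: the primes in [(2^i, 2^(i+1)]] divide the central binomial coefficient,
which is at most [2^(2^(i+1))]. *)
Lemma primorial_leq (i : nat) :
  (\prod_(0 <= p < (2 ^ i).+1 | prime p) p <= 4 ^ (2 ^ i))%N.
Proof.
elim: i => [|i IH]; first by rewrite big_mkcond /= unlock.
have e : (2 ^ i.+1 = 2 ^ i + 2 ^ i)%N by rewrite expnS mul2n addnn.
rewrite (@big_cat_nat _ _ _ (2 ^ i).+1) //=; last by rewrite e; lia.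
rewrite {2}e expnD leq_mul // e.
have := prod_primes_dvd_bin _ _ (leqnn (2 ^ i)%N).
move/dvdn_leq; rewrite bin_gt0 leq_addr => /(_ isT) H; apply: leq_trans H _.
by apply: leq_trans (bin_leq_exp2 _ _) _; rewrite addnn -mul2n expnM.
Qed.

(** Legendre's formula: each [k] contributes [2m/p^k - 2 (m/p^k)], rounded down, which
is 0 or 1 and vanishes once [p^k > 2m]. *)
Lemma logn_central_bin (p m : nat) : prime p -> (0 < m)%N ->
  (p ^ logn p 'C(m.*2, m) <= m.*2)%N.
Proof.
move=> pp m0; have p1 := prime_gt1 pp.
have m20 : (0 < m.*2)%N by rewrite double_gt0.
apply: leq_trans (_ : p ^ trunc_log p m.*2 <= _)%N; last exact: trunc_logP.
rewrite leq_exp2l //.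
have le : (m <= m.*2)%N by lia.
have C0 : (0 < 'C(m.*2, m))%N by rewrite bin_gt0.
have := bin_fact le; have -> : (m.*2 - m = m)%N by lia.
move=> /(congr1 (logn p)).
rewrite !lognM ?muln_gt0 ?fact_gt0 // !logn_fact //.
set A := (\sum_(1 <= k < m.+1) _)%N.
have -> : A = (\sum_(1 <= k < m.*2.+1) m %/ p ^ k)%N.
  rewrite [RHS](@big_cat_nat _ _ _ m.+1) //= [X in (_ + X)%N]big1_seq ?addn0 //.
  move=> k /andP[_]; rewrite mem_index_iota => /andP[mk _].
  apply: divn_small; apply: leq_trans (ltn_expl k p1); lia.
set B := (\sum_(1 <= k < m.*2.+1) m %/ p ^ k)%N => e.
suff : (\sum_(1 <= k < m.*2.+1) m.*2 %/ p ^ k <= trunc_log p m.*2 + (B + B))%N by lia.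
have -> : trunc_log p m.*2 =
   (\sum_(1 <= k < m.*2.+1) (k <= trunc_log p m.*2))%N.
  have lt : (trunc_log p m.*2 <= m.*2)%N.
    by apply: leq_trans (trunc_logP p1 m20); apply/ltnW/ltn_expl.
  rewrite (@big_cat_nat _ _ _ (trunc_log p m.*2).+1) //=.
  rewrite [X in (_ + X)%N]big1_seq ?addn0; last first.
    by move=> k /andP[_]; rewrite mem_index_iota => /andP[mk _]; rewrite leqNgt mk.
  rewrite (eq_big_nat _ _ (F2 := fun => 1%N)); last by move=> k /andP[_]; rewrite ltnS => ->.
  by rewrite sum_nat_const_nat; lia.
rewrite -!big_split /= leq_sum // => k _.
have q0 : (0 < p ^ k)%N by rewrite expn_gt0 prime_gt0.
case: (leqP k (trunc_log p m.*2)) => h; last first.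
rewrite divn_small // ltnNge; apply/negP => /(trunc_log_max p1); lia.
have := divn_eq m (p ^ k); have := ltn_pmod m q0.
set a := (m %/ _)%N; set r := (m %% _)%N => r0 em.
rewrite -ltnS ltn_divLR //; nia.
Qed.

Lemma prod_prime_logn (c M : nat) : (0 < c)%N ->
  (forall p, prime p -> (p %| c)%N -> (p <= M)%N) ->
  c = (\prod_(0 <= p < M.+1 | prime p) p ^ logn p c)%N.
Proof.
move=> c0 hM; rewrite -[LHS](partnT c0).
rewrite (@widen_partn (maxn c M) _ c) ?leq_maxl //.
rewrite (@big_cat_nat _ _ _ M.+1) //=; last by rewrite ltnS leq_maxr.
rewrite [X in (_ * X)%N]big1_seq ?muln1; last first.
  move=> p /andP[_]; rewrite mem_index_iota => /andP[Mp _].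
  case: (boolP (prime p)) => pp; last by rewrite /logn (negPf pp).
  rewrite (_ : logn p c = 0%N) //; apply/eqP; rewrite -leqn0 leqNgt.
  rewrite logn_gt0 mem_primes pp c0 /=; apply/negP => /hM-/(_ pp); lia.
rewrite [RHS]big_mkcond /=; apply: eq_bigr => p _.
by case: ifP => // pp; rewrite /logn pp.
Qed.

(** Absorbs the contribution of the primes up to the square root in [chebyshev_lower]. *)
Lemma linear_leq_exp2_half (i : nat) : (12 <= i)%N ->
  ((i + 3) * 2 ^ (i./2 + 2) <= 2 ^ i)%N.
Proof.
move=> h; have := odd_double_half i; set j := i./2 => e.
suff : ((2 * j + odd i + 3) * 4 <= 2 ^ (j + odd i))%N.
  move=> H; rewrite -e expnD.
  have -> : (2 ^ (odd i + j.*2) = 2 ^ (j + odd i) * 2 ^ j)%N.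
    by rewrite -expnD; congr (_ ^ _)%N; lia.
  have : (0 < 2 ^ j)%N by rewrite expn_gt0.
  move: H; set X := (2 ^ (j + _))%N; set Y := (2 ^ j)%N; rewrite -!muln2; nia.
have j6 : (6 <= j)%N by case: (odd i) e; lia.
suff : ((2 * j + 3) * 4 <= 2 ^ j)%N.
  case: (odd i) => H; rewrite ?addn0 ?addn1 /= ?expnS; lia.
elim: j j6 {e h} => [|j IH] //; rewrite leq_eqVlt => /orP[/eqP <- //|].
rewrite ltnS => /IH; rewrite expnS; lia.
Qed.

(** Chebyshev's argument on the window of ratio 8. In the factorization of the central
binomial coefficient [C(2m, m) >= 2^m] with [2m = 2^(i+3)], primes up to about the
square root contribute at most [2m] each, the other primes up to [2^i] occur to the
first power and contribute at most [4^(2^i)] by [primorial_leq]; what is missing to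
[2^m] must come from the window. *)
Lemma chebyshev_lower (i : nat) : (12 <= i)%N ->
  (2 ^ i <= (i + 3) * \sum_((2 ^ i).+1 <= p < (2 ^ (i + 3)).+1 | prime p) 1)%N.
Proof.
move=> hi; set M := (2 ^ (i + 3))%N; set s := (i./2 + 2)%N.
set m := (2 ^ (i + 2))%N.
have Mm : M = m.*2 by rewrite /M /m -muln2 -expnSr; congr (_ ^ _)%N; lia.
have m0 : (0 < m)%N by rewrite expn_gt0.
have M0 : (0 < M)%N by rewrite expn_gt0.
set c := 'C(m.*2, m).
have c0 : (0 < c)%N by rewrite bin_gt0 -addnn leq_addr.
have cM p : prime p -> (p %| c)%N -> (p <= M)%N.
  move=> pp pc; rewrite Mm; apply: leq_trans (logn_central_bin _ _ pp m0).
  by rewrite -{1}(expn1 p) leq_exp2l ?prime_gt1 // logn_gt0 mem_primes pp c0.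
have le1 : (c <= \prod_(0 <= p < M.+1 | prime p)
   ((if p <= 2 ^ s then M else 1) *
    ((if p <= 2 ^ i then p else 1) * (if 2 ^ i < p then M else 1))))%N.
  rewrite {1}(prod_prime_logn _ _ c0 cM); apply: leq_prod => p pp.
  have v := logn_central_bin _ _ pp m0; rewrite -/c -Mm in v.
  have p0 := prime_gt0 pp.
  case: (leqP p (2 ^ s)) => ps.
    apply: leq_trans v _; apply: leq_pmulr; rewrite muln_gt0.
    by apply/andP; split; case: ifP.
  rewrite mul1n; case: (leqP p (2 ^ i)) => pi /=; last by rewrite mul1n.
  rewrite muln1; apply: (@leq_trans (p ^ 1)); last by rewrite expn1.
  rewrite leq_exp2l ?(prime_gt1 pp) // leqNgt; apply/negP => v2.
  suff : (M < M)%N by rewrite ltnn.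
  apply: (fun h => leq_trans h v); apply: (@leq_trans (p ^ 2)); last first.
    by rewrite leq_exp2l // prime_gt1.
  apply: (@leq_trans ((2 ^ s).+1 ^ 2)); last by rewrite leq_exp2r.
  apply: (@leq_ltn_trans ((2 ^ s) ^ 2)); last by rewrite ltn_exp2r.
  rewrite -expnM leq_exp2l // /s; have := odd_double_half i.
  by case: (odd i); lia.
have lec : (2 ^ m <= c)%N by exact: exp2_leq_central_bin.
move: (leq_trans lec le1); rewrite !big_split /=.
set P1 := (\prod_(0 <= p < M.+1 | prime p) (if (p <= 2 ^ s)%N then M else 1%N))%N.
set P2 := (\prod_(0 <= p < M.+1 | prime p) (if (p <= 2 ^ i)%N then p else 1%N))%N.
set P3 := (\prod_(0 <= p < M.+1 | prime p) _)%N.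
have iM : (2 ^ i <= M)%N by rewrite leq_exp2l //; lia.
have si : (2 ^ s <= M)%N.
  by rewrite leq_exp2l // /s; have := odd_double_half i; case: (odd i); lia.
have P2le : (P2 <= 4 ^ (2 ^ i))%N.
  apply: leq_trans (primorial_leq i); rewrite /P2 (@big_cat_nat _ _ _ (2 ^ i).+1) //=.
  rewrite [X in (_ * X)%N]big1_seq ?muln1; last first.
    by move=> p /andP[_]; rewrite mem_index_iota => /andP[lt _]; rewrite leqNgt lt.
  by apply: leq_prod => p /prime_gt0 p0; case: ifP.
have P1le : (P1 <= M ^ (2 ^ s))%N.
  rewrite /P1 (@big_ltn_cond _ _ _ 0) //= (@big_cat_nat _ _ _ (2 ^ s).+1) //=.
  rewrite [X in (_ * X)%N]big1_seq ?muln1; last first.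
    by move=> p /andP[_]; rewrite mem_index_iota => /andP[lt _]; rewrite leqNgt lt.
  apply: leq_trans (_ : \prod_(1 <= p < (2 ^ s).+1) M <= _)%N.
    rewrite big_mkcond; apply: leq_prod => p _.
    by case: ifP => _ //; case: ifP.
  by rewrite prod_nat_const_nat subn1.
have -> : P3 = (M ^ \sum_((2 ^ i).+1 <= p < M.+1 | prime p) 1)%N.
  rewrite /P3 (@big_cat_nat _ _ _ (2 ^ i).+1) //=.
  rewrite [X in (X * _)%N]big1_seq ?mul1n; last first.
    by move=> p /andP[_]; rewrite mem_index_iota => /andP[_ lt]; rewrite ltnNge -ltnS lt.

  rewrite expn_sum big_seq_cond [RHS]big_seq_cond; apply: eq_bigr => p; rewrite mem_index_iota.
  by case/andP=> /andP[-> _] _; rewrite expn1.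
set n := (\sum_(_ <= p < _ | prime p) 1)%N => H.
have {}H : (2 ^ m <= M ^ 2 ^ s * (4 ^ 2 ^ i * M ^ n))%N.
  by apply: leq_trans H _; rewrite !leq_mul.
(* Comparison of the exponents of 2. *)
have {}H : (m <= (i + 3) * 2 ^ s + (2 * 2 ^ i + (i + 3) * n))%N.
  by move: H; rewrite /M -!expnM -(expnM 2 2) -!expnD leq_exp2l.
have := linear_leq_exp2_half _ hi; rewrite -/s => H2.
have em : m = (4 * 2 ^ i)%N by rewrite /m expnD mulnC.
move: H H2; rewrite em; lia.
Qed.

(** A form of [(1 + 1/y)^(y/2) <= 2] free of the exponential function; it follows
from Bernoulli's inequality for [(1 - 1/(y+1))^j]. *)
Lemma leq_succ_exp_double (z : nat) : (0 < z)%N ->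
  ((2 * z).+1 ^ z <= 2 * (2 * z) ^ z)%N.
Proof.
move=> z0; set y := (2 * z)%N.
have H j : (j <= z)%N -> (y.+1 ^ j * (y - j) <= y ^ j.+1)%N.
  elim: j => [|j IH] jz; first by rewrite expn0 mul1n subn0 expn1.
  have {IH} := IH (ltnW jz).
  rewrite (expnSr y.+1 j) (expnS y j.+1); set X := (y.+1 ^ j)%N; set Z := (y ^ j.+1)%N.
  have -> : (y - j = (y - j.+1).+1)%N by lia.
  have : (y - j.+1 <= y)%N by lia.
  set d := (y - j.+1)%N => dy H.
  apply: (@leq_trans (y * (X * d.+1))); last by rewrite leq_mul2l H orbT.
  rewrite -mulnA [leqRHS]mulnCA leq_mul2l; apply/orP; right; nia.
have := H z (leqnn z); have -> : (y - z = z)%N by lia.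
rewrite expnS; set X := (_ ^ z)%N; set Z := (_ ^ z)%N.
rewrite /y -mulnA mulnC [leqRHS]mulnCA leq_mul2l; case/orP=> //; lia.
Qed.

(** The coefficient is subexponential when [h] is a small multiple of [m]: from
[C(m+h, h) * y^m <= (1 + y)^(m+h)] and [leq_succ_exp_double] with [y = 8k]. *)
Lemma bin_small_exp2 (k m h : nat) : (0 < k)%N -> (h * (16 * k ^ 2) <= m)%N ->
  ('C(m + h, h) ^ k <= 2 ^ m)%N.
Proof.
move=> k0 hm; set M := (m + h)%N; set C := 'C(M, h).
set z := (4 * k)%N; set y := (2 * z)%N.
have z0 : (0 < z)%N by rewrite /z; lia.
have y0 : (0 < y)%N by rewrite /y; lia.
have h1 : (C * y ^ m <= y.+1 ^ M)%N.
  have hM : (h < M.+1)%N by rewrite /M; lia.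
  rewrite -addn1 Pascal (bigD1 (Ordinal hM)) //=.
  by rewrite /M addnK exp1n muln1; apply: leq_addr.
have h2 : (C ^ z * y ^ (m * z) <= 2 ^ M * y ^ (h * z) * y ^ (m * z))%N.
  apply: (@leq_trans (y.+1 ^ (M * z))).
    by rewrite expnM (expnM y.+1) -expnMn leq_exp2r.
  rewrite -mulnA -expnD -mulnDl (addnC h) -/M mulnC expnM.
  rewrite (expnM y z) -expnMn.
  case: (posnP M) => [->|M0]; first by rewrite !expn0.
  by rewrite leq_exp2r // leq_succ_exp_double.
rewrite leq_mul2r expn_eq0 eqn0Ngt y0 /= in h2.
rewrite -(@leq_exp2r _ _ 4) // -expnM mulnC -/z.
apply: (leq_trans h2).
have hy : (y ^ (h * z) <= 2 ^ (y * (h * z)))%N.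
  rewrite [leqRHS]expnM; case: (posnP (h * z)) => [->|p0]; first by rewrite !expn0.
  by rewrite leq_exp2r // ltnW // ltn_expl.
apply: (leq_trans (leq_mul (leqnn _) hy)).
rewrite -expnD -expnM leq_exp2l // /M /y /z; nia.
Qed.

(** The substitute for a sieve: the number of primes in [(m, m + m/(16 k^2)]] is at most
[1/k] times the order [m / log m] of the number of primes up to [m]. *)
Lemma primes_short_interval (i k m h : nat) :
  (0 < k)%N -> (2 ^ i <= m)%N -> (h * (16 * k ^ 2) <= m)%N ->
  (i * k * \sum_(m.+1 <= p < (m + h).+1 | prime p) 1 <= m)%N.
Proof.
move=> k0 im hm; set n := (\sum_(_ <= p < _ | _) _)%N.
have hm1 : (h <= m)%N by nia.
rewrite -(@leq_exp2l 2) //; apply: leq_trans (bin_small_exp2 _ _ _ k0 hm).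
rewrite -mulnA (mulnC k) mulnA expnM leq_exp2r //.
have := prod_primes_dvd_bin _ _ hm1; move/dvdn_leq; rewrite bin_gt0 leq_addl.
move=> /(_ isT); apply: leq_trans.
rewrite expnM /n expn_sum big_seq_cond [leqRHS]big_seq_cond.
apply: leq_prod => p; rewrite mem_index_iota expn1 => /andP[/andP[mp _] _].
by apply: leq_trans im _; apply: ltnW.
Qed.

(** * The mass of a set of primes: sums of reciprocals *)

Definition pmass (R : realType) (Q : pred nat) (Y : nat) : R :=
  \sum_(0 <= p < Y | prime p && Q p) p%:R^-1.

Lemma pmass_mono (R : realType) (Q1 Q2 : pred nat) (Y : nat) :
  (forall p, prime p -> (p < Y)%N -> Q1 p -> Q2 p) -> pmass R Q1 Y <= pmass R Q2 Y.
Proof.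
move=> H; rewrite /pmass big_seq_cond [leRHS]big_seq_cond.
rewrite big_mkcond [leRHS]big_mkcond; apply: ler_sum => p _.
case: ifP => [/and3P[py pp q]|_]; last by case: ifP => _ //; rewrite invr_ge0.
rewrite py pp /= H //; by move: py; rewrite mem_index_iota.
Qed.

Lemma pmassU (R : realType) (Q1 Q2 : pred nat) (Y : nat) :
  pmass R [pred p | Q1 p || Q2 p] Y <= pmass R Q1 Y + pmass R Q2 Y.
Proof.
rewrite /pmass big_mkcond [X in _ <= X + _]big_mkcond [X in _ <= _ + X]big_mkcond.
rewrite -big_split; apply: ler_sum => p _ /=.
have : 0 <= p%:R^-1 :> R by rewrite invr_ge0.
by case: (prime p) => //=; case: (Q1 p); case: (Q2 p) => /=; lra.
Qed.

(** A prime lies in at most one of the windows [W j], so that it is counted at most once. *)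
Lemma pmass_disjoint (R : realType) (Q : pred nat) (W : nat -> pred nat)
    (D : pred nat) (n1 n2 Y : nat) :
  (forall i j p, W i p -> W j p -> i = j) ->
  \sum_(n1 <= j < n2 | D j) pmass R [pred p | Q p && W j p] Y <= pmass R Q Y.
Proof.
move=> dis; rewrite /pmass.
under eq_bigr => j _ do rewrite big_mkcond /=.
rewrite exchange_big /= [leRHS]big_mkcond; apply: ler_sum => p _.
have p0 : 0 <= p%:R^-1 :> R by rewrite invr_ge0.
rewrite big_mkcond /=.
case: (pselect (exists2 j0, j0 \in index_iota n1 n2 & W j0 p)) => [[j0 jn w]|no].
  rewrite (bigD1_seq j0) ?iota_uniq //= big1 => [|j jj]; last first.
    have -> : W j p = false.
      by apply: contraNF jj => w'; apply/eqP; apply: (dis _ _ _ w' w).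
    by rewrite !andbF; case: ifP.
  by rewrite w andbT addr0; case: (D j0); case: ifP.
rewrite big1_seq; first by case: ifP.
move=> j /andP[_ jn]; have -> : W j p = false.
  by apply/negP => w; apply: no; exists j.
by rewrite !andbF; case: ifP.
Qed.

Lemma pmass_leY (R : realType) (Q : pred nat) (Y Y' : nat) : (Y <= Y')%N ->
  pmass R Q Y <= pmass R Q Y'.
Proof.
move=> h; rewrite [leRHS]/pmass (@big_cat_nat _ _ _ Y) //= lerDl.
by apply: sumr_ge0 => p _; rewrite invr_ge0.
Qed.

Lemma pmass_itv (R : realType) (a b Y : nat) : (a <= b)%N -> (b < Y)%N ->
  pmass R [pred p | (a < p <= b)%N] Y =
  \sum_(a.+1 <= p < b.+1 | prime p) p%:R^-1.
Proof.
move=> ab bY.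
rewrite /pmass (@big_cat_nat _ _ _ a.+1) //=; last by lia.
rewrite (@big_cat_nat _ _ _ b.+1 _ Y) //=.
rewrite big1_seq => [|p]; last first.
  by rewrite mem_index_iota => /andP[/andP[_ /andP[p1 _]] p2]; lia.
rewrite [X in _ + (_ + X)]big1_seq => [|p]; last first.
  by rewrite mem_index_iota => /andP[/andP[_ /andP[_ p1]] p2]; lia.
rewrite add0r addr0 big_seq_cond [RHS]big_seq_cond; apply: eq_bigl => p.
by rewrite mem_index_iota ltnS; case: (_ < p <= _)%N; rewrite ?andbT ?andbF.
Qed.

Lemma pmass_window (R : realType) (i Y : nat) : (12 <= i)%N -> (2 ^ (i + 3) < Y)%N ->
  (8 * (i + 3))%:R^-1 <= pmass R [pred p | (2 ^ i < p <= 2 ^ (i + 3))%N] Y.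
Proof.
move=> i12 Yi; have := chebyshev_lower _ i12.
set n := (\sum_(_ <= p < _ | _) _)%N => hn.
have i2 : (2 ^ i <= 2 ^ (i + 3))%N by rewrite leq_exp2l //; lia.
rewrite pmass_itv //.
apply: (@le_trans _ _ (n%:R * (2 ^ (i + 3))%:R^-1)).
  rewrite ler_pdivlMr ?ltr0n ?expn_gt0 // mulrC ler_pdivrMr ?ltr0n; last by lia.
  rewrite -natrM ler_nat expnD; lia.
rewrite /n natr_sum mulr_suml big_seq_cond [leRHS]big_seq_cond.
apply: ler_sum => p; rewrite mem_index_iota ltnS mul1r => /andP[/andP[p1 p2] _].
by rewrite lef_pV2 ?ler_nat // posrE ltr0n ?expn_gt0 // (leq_ltn_trans _ p1).
Qed.

(** Primes confined to a very short interval have mass at most [1/(i k)], by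
[primes_short_interval]; the first term accounts for the left end point. *)
Lemma pmass_cluster (R : realType) (Q : pred nat) (i k p0 h Y : nat) :
  (0 < i)%N -> (0 < k)%N -> (2 ^ i <= p0)%N -> (h * (16 * k ^ 2) <= p0)%N ->
  (forall p, prime p -> (p < Y)%N -> Q p -> (p0 <= p <= p0 + h)%N) ->
  pmass R Q Y <= (2 ^ i)%:R^-1 + (i * k)%:R^-1.
Proof.
move=> i0 k0 ip hp H.
have i2 : (0 < 2 ^ i)%N by rewrite expn_gt0.
have p00 : (0 < p0)%N by lia.
have p0R : (0 : R) < p0%:R by rewrite ltr0n.
apply: (@le_trans _ _ (pmass R [pred p | (p0.-1 < p <= p0 + h)%N] (Y + p0 + h).+1)).
  apply: (@le_trans _ _ (pmass R [pred p | (p0.-1 < p <= p0 + h)%N] Y)).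
    by apply: pmass_mono => p pp pY /(H _ pp pY) /=; lia.
  by apply: pmass_leY; lia.
rewrite pmass_itv ?prednK //; [|lia|lia].
have := primes_short_interval _ _ _ _ k0 ip hp.
set n := (\sum_(_ <= p < _ | _) _)%N => hn.
apply: (@le_trans _ _ (p0%:R^-1 + n%:R * p0%:R^-1)); last first.
  apply: lerD; first by rewrite lef_pV2 ?ler_nat ?posrE ?ltr0n.
  rewrite ler_pdivrMr // mulrC ler_pdivlMr ?ltr0n ?muln_gt0 ?i0 //.
  by rewrite -natrM ler_nat mulnC.
rewrite big_ltn_cond; last by lia.
have le : \sum_(p0.+1 <= i1 < (p0 + h).+1 | prime i1) i1%:R^-1 <= n%:R * p0%:R^-1 :> R.
  rewrite /n natr_sum mulr_suml big_seq_cond [leRHS]big_seq_cond.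
  apply: ler_sum => p; rewrite mem_index_iota mul1r => /andP[/andP[p1 p2] _].
  by rewrite lef_pV2 ?ler_nat ?posrE ?ltr0n //; lia.
have : 0 <= p0%:R^-1 :> R by rewrite invr_ge0 ltW.
by case: ifP => _; lra.
Qed.

Lemma harmonic_unbounded (R : realType) (n0 : nat) (L : R) :
  exists n, L < \sum_(n0 <= j < n) j.+1%:R^-1.
Proof.
apply: contrapT => no; apply: (@dvg_harmonic R).
apply: nondecreasing_is_cvgn.
  by apply/nondecreasing_seqP => n; rewrite /series /= big_nat_recr //= lerDl invr_ge0.
exists (\sum_(0 <= j < n0) j.+1%:R^-1 + L) => _ [n _ <-]; rewrite /series /=.
case: (leqP n0 n) => h.
  rewrite (@big_cat_nat _ _ _ n0) //= lerD2l.
  by rewrite leNgt; apply/negP => h'; apply: no; exists n.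
have L0 : 0 <= L.
  rewrite leNgt; apply/negP => h'; apply: no; exists n0.
  by rewrite big_geq.
rewrite [leRHS]addrC (@big_cat_nat _ _ _ n 0 n0) //=; last exact: ltnW.
have : 0 <= \sum_(n <= i < n0) i.+1%:R^-1 :> R.
  by apply: sumr_ge0 => p _; rewrite invr_ge0.
rewrite /harmonic; lra.
Qed.

(** * Pairs of primes with ratio close to 1 *)

(** Multiplicatively: [1 + 1/t <= q / p <= 1 + 1/e]. *)
Definition narrow_pair (e t p q : nat) : bool :=
  (t.+1 * p <= t * q)%N && (e * q <= e.+1 * p)%N.

(** In a block of ratio [1 + 1/e] the upper ratio condition is automatic, so that without
narrow pairs all primes of [G] lie within ratio [1 + 1/t] of the least one, and
[pmass_cluster] applies. *)
Lemma pmass_block (R : realType) (G : pred nat) (e i k Y : nat) (x : R) :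
  (0 < i)%N -> (0 < k)%N -> (2 ^ i)%:R <= x ->
  (forall p q, prime p -> prime q -> (p < Y)%N -> (q < Y)%N -> G p -> G q ->
     ~~ narrow_pair e (16 * k ^ 2) p q) ->
  pmass R [pred p | G p && (x < p%:R) && (e%:R * p%:R <= e.+1%:R * x)] Y
    <= (2 ^ i)%:R^-1 + (i * k)%:R^-1.
Proof.
move=> i0 k0 ix H; set Q := [pred p | _].
set t := (16 * k ^ 2)%N in H *.
have t0 : (0 < t)%N by rewrite /t; nia.
case: (pselect (exists p, [&& prime p, Q p & (p < Y)%N])) => [ex|no]; last first.
  rewrite /pmass big1_seq ?addr_ge0 ?invr_ge0 // => p /andP[/andP[pp pq]].
  rewrite mem_index_iota => /andP[_ pY]; case: no; exists p.
  by rewrite pp pq pY.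
case: (ex_minnP ex) => p0 /and3P[pp0 /= /andP[/andP[G0 x0] e0] Y0] mn.
apply: (@pmass_cluster _ _ i k p0 (p0 %/ t)%N Y) => //.
- by rewrite -(ler_nat R); apply: le_trans ix (ltW x0).
- exact: leq_trunc_div.
move=> p pp pY Qp; have p0p : (p0 <= p)%N by apply: mn; rewrite pp pY andbT; exact: Qp.
rewrite p0p /=; move: Qp => /= /andP[/andP[Gp xp] ep].
have := H _ _ pp0 pp Y0 pY G0 Gp; rewrite negb_and => /orP[]; last first.
  have -> // : (e * p <= e.+1 * p0)%N.
  rewrite -(ler_nat R) !natrM; apply: le_trans ep _.
  by rewrite ler_pM2l ?ltr0n // ltW.
rewrite -ltnNge => lt.
have : ((p - p0) * t <= p0)%N by nia.
rewrite -leq_divRL //; lia.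
Qed.

Lemma pmass_blocks (R : realType) (G : pred nat) (e i k Y K : nat) (x : R) :
  (0 < i)%N -> (0 < k)%N -> (0 < e)%N -> (2 ^ i)%:R <= x ->
  (forall p q, prime p -> prime q -> (p < Y)%N -> (q < Y)%N -> G p -> G q ->
     ~~ narrow_pair e (16 * k ^ 2) p q) ->
  pmass R [pred p | G p && (x < p%:R <= x * (1 + e%:R^-1) ^+ K)] Y
    <= K%:R * ((2 ^ i)%:R^-1 + (i * k)%:R^-1).
Proof.
move=> i0 k0 e0 ix H; have eR : (0 : R) < e%:R by rewrite ltr0n.
elim: K x ix => [|K IH] x ix.
  rewrite mul0r /pmass big1 // => p /andP[_] /= /andP[_].
  by rewrite expr0 mulr1 => /andP[/lt_le_trans h /h]; rewrite ltxx.
set r := 1 + e%:R^-1; have r1 : 1 <= r by rewrite lerDl invr_ge0.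
have x0 : 0 <= x by apply: le_trans ix.
have ixr : (2 ^ i)%:R <= x * r by apply: le_trans ix _; rewrite ler_peMr.
have := pmass_block _ _ _ _ _ _ _ i0 k0 ix H.
have := IH _ ixr.
set A := pmass _ _ _; set B := pmass _ _ _ => hA hB.
apply: (@le_trans _ _ (B + A)); last by rewrite -natr1; lra.
apply: le_trans (pmassU _ _ _ _); apply: pmass_mono => p pp pY /=.
case/andP=> -> /andP[xp]; rewrite xp exprS mulrA => -> /=.
rewrite andbT; case: (ltP (x * r) p%:R) => h2; rewrite ?orbT // orbF.
have : e%:R * p%:R <= e%:R * (x * r) :> R by rewrite ler_pM2l.
suff -> : e%:R * (x * r) = e.+1%:R * x :> R by [].
by rewrite /r -natr1; field; rewrite gt_eqF.
Qed.

Lemma expr_bernoulli8 (R : realType) (e : nat) : (0 < e)%N ->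
  8 <= (1 + e%:R^-1) ^+ (7 * e) :> R.
Proof.
move=> e0; have H n : 1 + n%:R * e%:R^-1 <= (1 + e%:R^-1) ^+ n :> R.
  elim: n => [|n IH]; first by rewrite mul0r addr0 expr0.
  rewrite exprS -natr1; have : 0 <= e%:R^-1 :> R by rewrite invr_ge0.
  have : 0 <= n%:R :> R by [].
  move: IH; set u := e%:R^-1; set v := n%:R; set w := _ ^+ n => ? ? ?.
  have : (1 + u) * (1 + v * u) <= (1 + u) * w by rewrite ler_wpM2l //; lra.
  have : 0 <= u * (v * u) by rewrite !mulr_ge0.
  lra.
apply: le_trans (H _); rewrite natrM mulfK ?pnatr_eq0 -?lt0n //; lra.
Qed.

(** If the primes avoiding [B] contained no narrow pair, then [pmass_blocks] would bound
their mass in each window of ratio 8 by half of what [pmass_window] provides. So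
[B] would have mass at least [c / j] in the [j]-th window, and its total mass would
exceed [L]. *)
Lemma narrow_pairs_exist (R : realType) (e : nat) : (0 < e)%N ->
  exists t, (0 < t)%N /\ forall L : R, exists Y, forall B : pred nat,
    pmass R B Y <= L -> exists p q, [/\ prime p, prime q, ((p < Y) && (q < Y))%N,
     ~~ B p && ~~ B q & narrow_pair e t p q].
Proof.
move=> e0; set k := (448 * e)%N; set i0 := (2 * e + 12)%N.
have k0 : (0 < k)%N by rewrite /k; lia.
(* [k] is large enough for the at most [7 e] blocks that cover a window, each of mass
   about [1/(i k)], to stay below half of the mass [1/(8 (i + 3))] of the window. *)
exists (16 * k ^ 2)%N; split; first by nia.
move=> L.
pose c : R := (16 * (i0 + 3))%:R^-1.
have c0 : 0 < c by rewrite invr_gt0 ltr0n; lia.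
have [n hn] := @harmonic_unbounded R 0 (L / c).
exists (2 ^ (i0 + 3 * n + 3)).+1; set Y := (_.+1) => B hB.
apply: contrapT => no.
pose G := [pred p | ~~ B p].
have H p q : prime p -> prime q -> (p < Y)%N -> (q < Y)%N -> G p -> G q ->
     ~~ narrow_pair e (16 * k ^ 2) p q.
  move=> pp pq pY qY Gp Gq; apply/negP => np; apply: no; exists p, q.
  by split=> //; [rewrite pY | apply/andP].
pose W j := [pred p | (2 ^ (i0 + 3 * j) < p <= 2 ^ (i0 + 3 * j + 3))%N].
have dis i j p : W i p -> W j p -> i = j.
  have aux a b : (2 ^ (i0 + 3 * a) < p)%N -> (p <= 2 ^ (i0 + 3 * b + 3))%N -> (a <= b)%N.
    move=> h1 h2; have := leq_trans h1 h2; rewrite ltn_exp2l //; lia.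
  move=> /andP[h1 h2] /andP[h3 h4]; apply/eqP; rewrite eqn_leq.
  by rewrite (aux _ _ h1 h4) (aux _ _ h3 h2).
have := @pmass_disjoint R B W xpredT 0 n Y dis.
suff : c * \sum_(0 <= j < n) j.+1%:R^-1 <=
   \sum_(0 <= j < n) pmass R [pred p | B p && W j p] Y.
  move: hn; rewrite ltr_pdivrMr // mulrC; lra.
rewrite mulr_sumr big_seq [leRHS]big_seq; apply: ler_sum => j.
rewrite mem_index_iota => /andP[_ jn].
set i := (i0 + 3 * j)%N in W dis *.
have i12 : (12 <= i)%N by rewrite /i /i0; lia.
have ipos : (0 < i)%N by lia.
have iY : (2 ^ (i + 3) < Y)%N by rewrite ltnS leq_exp2l // /i; lia.
have m1 := pmass_window R _ _ i12 iY.
have m2 := @pmass_blocks R G e i k Y (7 * e) (2 ^ i)%:R ipos k0 e0 (lexx _) H.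
have m3 : pmass R [pred p | (2 ^ i < p <= 2 ^ (i + 3))%N] Y <=
   pmass R [pred p | B p && W j p] Y +
   pmass R [pred p | G p && ((2 ^ i)%:R < (p%:R : R) <= (2 ^ i)%:R * (1 + e%:R^-1) ^+ (7 * e))] Y.
  apply: le_trans (pmassU _ _ _ _); apply: pmass_mono => p pp pY /= h.
  rewrite -/i h andbT; case: (B p) => //=.
  case/andP: h => h1 h2; rewrite ltr_nat h1 /=.
  apply: (@le_trans _ _ ((2 ^ i)%:R * 8)).
    by rewrite -natrM ler_nat; move: h2; rewrite expnD.
  by rewrite ler_pM2l ?ltr0n ?expn_gt0 // expr_bernoulli8.
have x0 : (i + 3)%:R != 0 :> R by rewrite pnatr_eq0; lia.
have m4 : (7 * e)%:R * ((2 ^ i)%:R^-1 + (i * k)%:R^-1) <= (16 * (i + 3))%:R^-1 :> R.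
  have s1 : (7 * e)%:R * (2 ^ i)%:R^-1 <= (32 * (i + 3))%:R^-1 :> R.
    rewrite ler_pdivrMr ?ltr0n ?expn_gt0 // mulrC ler_pdivlMr ?ltr0n; last by lia.
    rewrite -natrM ler_nat; have := linear_leq_exp2_half _ i12.
    have : (256 * e <= 2 ^ (i./2 + 2))%N.
      have -> : (256 = 2 ^ 8)%N by [].
      apply: (@leq_trans (2 ^ 8 * 2 ^ e)).
        by rewrite leq_pmul2l ?expn_gt0 //; exact/ltnW/ltn_expl.
      rewrite -expnD leq_exp2l //.
      have := odd_double_half i.
      have : (2 * e + 12 <= i)%N by rewrite /i /i0; lia.
      by case: odd; lia.
    set X := (2 ^ (i./2 + 2))%N; set Z := (2 ^ i)%N => hX hZ.
    apply: leq_trans hZ; apply: (@leq_trans ((i + 3) * (256 * e))).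
      by have := leq0n (i * e); clear; lia.
    by rewrite leq_mul2l hX orbT.
  have s2 : (7 * e)%:R * (i * k)%:R^-1 <= (32 * (i + 3))%:R^-1 :> R.
    rewrite ler_pdivrMr ?ltr0n ?muln_gt0 ?ipos // mulrC ler_pdivlMr ?ltr0n; last by lia.
    rewrite -natrM ler_nat /k.
    have : (0 < i * e)%N by rewrite muln_gt0 ipos.
    have : (e * 12 <= e * i)%N by rewrite leq_mul2l i12 orbT.
    clear; lia.
  have -> : (16 * (i + 3))%:R^-1 = (32 * (i + 3))%:R^-1 + (32 * (i + 3))%:R^-1 :> R.
    by rewrite !natrM; move: x0; set x := (i + 3)%:R => x0; field.
  lra.
have m5 : (8 * (i + 3))%:R^-1 = (16 * (i + 3))%:R^-1 + (16 * (i + 3))%:R^-1 :> R.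
  by rewrite !natrM; move: x0; set x := (i + 3)%:R => x0; field.
have m6 : c * j.+1%:R^-1 <= (16 * (i + 3))%:R^-1.
  rewrite /c -invfM -natrM lef_pV2 ?posrE ?ltr0n ?ler_nat //; rewrite /i; nia.
apply: le_trans m6 _; rewrite -(lerD2r (16 * (i + 3))%:R^-1) -m5.
apply: le_trans m1 (le_trans m3 _); apply: lerD => //.
exact: le_trans m2 m4.
Qed.

(** * Omega and the Turan-Kubilius inequality *)

Lemma sum_multiples (V : nmodType) (F : nat -> V) (d N : nat) : (0 < d)%N ->
  \sum_(1 <= n < N.+1 | (d %| n)%N) F n = \sum_(1 <= m < (N %/ d)%N.+1) F (d * m)%N.
Proof.
move=> d0; elim: N => [|N IH]; first by rewrite div0n !big_nil.
rewrite big_mkcond big_nat_recr //= -big_mkcond IH divnS //.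
case: (boolP (d %| N.+1)%N) => h; last by rewrite add0n addr0.
rewrite add1n [RHS]big_nat_recr //=; congr (_ + F _).
by rewrite -[LHS](divnK h) divnS // h add1n mulnC.
Qed.

Lemma Omega_logn_sum (n B : nat) : (0 < n)%N -> (n <= B)%N ->
  Omega n = (\sum_(0 <= q < B.+1) logn q n)%N.
Proof.
move=> n0 nB.
rewrite /Omega (_ : primes n = [seq q <- index_iota 0 B.+1 | q \in primes n]).
  rewrite big_filter [RHS](bigID (mem (primes n))) /= [X in (_ + X)%N]big1 ?addn0 //.
  move=> q; rewrite -logn_gt0; lia.
apply: (irr_sorted_eq ltn_trans ltnn (sorted_primes n)).
  by apply: sorted_filter; [exact: ltn_trans | exact: iota_ltn_sorted].
move=> q; rewrite mem_filter mem_index_iota /=; case: (boolP (q \in _)) => //=.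
rewrite mem_primes => /and3P[_ _ /dvdn_leq]; lia.
Qed.

Lemma OmegaM (m n : nat) : (0 < m)%N -> (0 < n)%N ->
  Omega (m * n) = (Omega m + Omega n)%N.
Proof.
move=> m0 n0; rewrite !(Omega_logn_sum _ (m * n)) ?muln_gt0 ?m0 //; last 2 first.
- by rewrite leq_pmull.
- by rewrite leq_pmulr.
by rewrite -big_split; apply: eq_bigr => q _; rewrite lognM.
Qed.

Lemma Omega_exp (m k : nat) : (0 < m)%N -> Omega (m ^ k) = (k * Omega m)%N.
Proof.
move=> m0; elim: k => [|k IH]; first by rewrite expn0 /Omega big_nil.
by rewrite expnS OmegaM ?expn_gt0 ?m0 // IH mulSn.
Qed.

Lemma Omega_prime_mul (p m : nat) : prime p -> (0 < m)%N ->
  Omega (p * m) = (Omega m).+1.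
Proof.
move=> pp m0; rewrite OmegaM ?(prime_gt0 pp) // /Omega primes_prime // big_seq1.
by rewrite logn_prime // eqxx add1n.
Qed.

Lemma natr_divn_le (R : realType) (N d : nat) : (N %/ d)%:R <= N%:R / d%:R :> R.
Proof.
case: (posnP d) => [->|d0]; first by rewrite divn0 invr0 mulr0.
by rewrite ler_pdivlMr ?ltr0n // -natrM ler_nat leq_trunc_div.
Qed.

Lemma natr_divn_ge (R : realType) (N d : nat) : (0 < d)%N ->
  N%:R / d%:R - 1 <= (N %/ d)%:R :> R.
Proof.
move=> d0; rewrite lerBlDr ler_pdivrMr ?ltr0n // natr1 -natrM ler_nat.
by rewrite ltnW // ltn_ceil.
Qed.

(** Bounds the contribution of the [n] divisible by [p^2], where multiplication by [p]
need not preserve the weight. *)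
Lemma sum_inv_sqr_le1 (R : realType) (Q : pred nat) (Y : nat) :
  \sum_(2 <= p < Y | Q p) (p%:R^-1 * p%:R^-1) <= 1 :> R.
Proof.
have H n : \sum_(2 <= p < n.+2) (p%:R^-1 * p%:R^-1) <= 1 - n.+1%:R^-1 :> R.
  elim: n => [|n IH]; first by rewrite big_geq // invr1 subrr.
  rewrite big_nat_recr //=; apply: le_trans (lerD IH (lexx _)) _.
  have : n.+2%:R^-1 * n.+2%:R^-1 <= n.+1%:R^-1 * n.+2%:R^-1 :> R.
    by rewrite ler_pM2r ?invr_gt0 ?ltr0n // lef_pV2 ?posrE ?ltr0n // ler_nat.
  have -> : n.+1%:R^-1 * n.+2%:R^-1 = n.+1%:R^-1 - n.+2%:R^-1 :> R.
    rewrite -[n.+2%:R]natr1; have : n.+1%:R != 0 :> R by rewrite pnatr_eq0.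
    have : n.+1%:R + 1 != 0 :> R by rewrite natr1 pnatr_eq0.
    by move: (n.+1%:R : R) => x h1 h2; field; rewrite h1 h2.
  by move: (n.+1%:R^-1 : R) (n.+2%:R^-1 : R) => x y; lra.
case: Y => [|[|n]]; [by rewrite big_geq|by rewrite big_geq|].
apply: le_trans (le_trans (H n) _); last by rewrite lerBlDr lerDl invr_ge0.
by rewrite big_mkcond; apply: ler_sum => p _; case: ifP => _ //; rewrite mulr_ge0 ?invr_ge0.
Qed.

(** The second moment is computed from the fact that for distinct primes the events of
being divisible by [p] and by [q] are independent up to rounding. *)
Lemma turan_kubilius (R : realType) (Q : pred nat) (Y N : nat) :
  (forall p, Q p -> prime p) ->
  let L : R := \sum_(2 <= p < Y | Q p) p%:R^-1 in
  \sum_(1 <= n < N.+1) (\sum_(2 <= p < Y | Q p) (p %| n)%:R - L) ^+ 2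
    <= N%:R * L + 2 * L * Y%:R.
Proof.
move=> Qp; cbv zeta; set L : R := \sum_(2 <= p < Y | Q p) p%:R^-1; set om := fun n : nat => \sum_(2 <= p < Y | Q p) (p %| n)%:R : R.
have L0 : 0 <= L by apply: sumr_ge0 => p _; rewrite invr_ge0.
have cnt d : (0 < d)%N -> \sum_(1 <= n < N.+1) (d %| n)%:R = (N %/ d)%:R :> R.
  move=> d0; rewrite (eq_bigr (fun n => if (d %| n)%N then 1 else 0)) => [|n _].
    by rewrite -big_mkcond sum_multiples // sumr_const_nat subn1.
  by case: (d %| n)%N.
have S1 : N%:R * L - Y%:R <= \sum_(1 <= n < N.+1) om n.
  rewrite exchange_big /=.
  apply: (@le_trans _ _ (\sum_(2 <= p < Y | Q p) (N%:R * p%:R^-1 - 1))); last first.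
    by apply: ler_sum => p /Qp/prime_gt0 p0; rewrite cnt // natr_divn_ge.
  rewrite big_split /= -mulr_sumr lerD2l sumrN lerN2 big_mkcond /=.
  apply: (@le_trans _ _ (\sum_(2 <= p < Y) 1)).
    by apply: ler_sum => p _; case: ifP.
  by rewrite sumr_const_nat ler_nat leq_subr.
have S2 : \sum_(1 <= n < N.+1) om n ^+ 2 <= N%:R * L ^+ 2 + N%:R * L.
  have -> : \sum_(1 <= n < N.+1) om n ^+ 2 =
     \sum_(2 <= p < Y | Q p) \sum_(2 <= q < Y | Q q)
       \sum_(1 <= n < N.+1) (p %| n)%:R * (q %| n)%:R.
    rewrite (eq_bigr (fun n => \sum_(2 <= p < Y | Q p) \sum_(2 <= q < Y | Q q)
      (p %| n)%:R * (q %| n)%:R)) => [|n _].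
      by rewrite exchange_big; apply: eq_bigr => p _; rewrite exchange_big.
    by rewrite expr2 mulr_suml; apply: eq_bigr => p _; rewrite mulr_sumr.
  apply: (@le_trans _ _ (\sum_(2 <= p < Y | Q p) \sum_(2 <= q < Y | Q q)
     (N%:R * (p%:R^-1 * q%:R^-1) + N%:R * p%:R^-1 * (p == q)%:R))).
    apply: ler_sum => p /Qp pp; apply: ler_sum => q /Qp qp.
    have p0 := prime_gt0 pp; have q0 := prime_gt0 qp.
    case: eqP => [<-|/eqP pq].
      rewrite (eq_bigr (fun n => (p %| n)%:R)) => [|n _]; last first.
        by case: (p %| n)%N; rewrite ?mulr1 ?mulr0.
      rewrite cnt // mulr1; apply: le_trans (natr_divn_le _ _ _) _.
      by rewrite lerDr !mulr_ge0 ?invr_ge0.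
    rewrite mulr0 addr0 (eq_bigr (fun n => (p * q %| n)%:R)) => [|n _]; last first.
      rewrite Gauss_dvd; last by rewrite prime_coprime // dvdn_prime2.
      by case: (p %| n)%N; case: (q %| n)%N; rewrite ?mulr1 ?mulr0.
    rewrite cnt ?muln_gt0 ?p0 //; apply: le_trans (natr_divn_le _ _ _) _.
    by rewrite natrM invfM.
  rewrite [leRHS](_ : _ = \sum_(2 <= p < Y | Q p) (N%:R * p%:R^-1 * L + N%:R * p%:R^-1)).
    rewrite big_seq_cond [leRHS]big_seq_cond; apply: ler_sum => p /andP[pin pQ].
    rewrite big_split /=; apply: lerD.
      by rewrite -mulr_sumr -mulr_sumr mulrA.
    rewrite -mulr_sumr -[leRHS]mulr1 ler_wpM2l ?mulr_ge0 ?invr_ge0 //.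
    rewrite big_mkcond (bigD1_seq p) ?iota_uniq //= pQ eqxx big1 ?addr0 // => q.
    by rewrite eq_sym => /negPf ->; case: ifP.
  have e : \sum_(2 <= p < Y | Q p) N%:R * p%:R^-1 = N%:R * L by rewrite -mulr_sumr.
  by rewrite big_split /= -mulr_suml e expr2 mulrA.
rewrite (eq_bigr (fun n => om n ^+ 2 + (- (2 * L) * om n + L ^+ 2))); last first.
  by move=> n _; rewrite -/(om n); move: (om n) {S1 S2} L L0 => x y _; ring.
rewrite !big_split /= -mulr_sumr sumr_const_nat subn1 /=.
have : 2 * L * (N%:R * L - Y%:R) <= 2 * L * \sum_(1 <= n < N.+1) om n.
  by rewrite ler_wpM2l // mulr_ge0.
move: S2; set A := \sum_(_ <= _ < _) _; set B := \sum_(_ <= _ < _) _.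
rewrite -[X in _ + (_ + X)]mulr_natl; lra.
Qed.

(** * Weighted means along Omega and exceptional primes *)

(** Satisfied by the constant 1 and by the indicator of the squarefree numbers. *)
Definition prime_invariant (R : realType) (w : nat -> R) : Prop :=
  (forall n, 0 <= w n <= 1) /\
  (forall p m, prime p -> (0 < m)%N -> ~~ (p %| m)%N -> w (p * m)%N = w m).

Definition wsum (R : realType) (w a : nat -> R) (i x : nat) : R :=
  \sum_(1 <= n < x.+1) w n * a (Omega n + i)%N.

Definition wmean (R : realType) (w a : nat -> R) (i x : nat) : R :=
  wsum R w a i x / x%:R.

Lemma weight_term_le1 (R : realType) (w a : nat -> R) (n j : nat) :
  prime_invariant R w -> (forall m, `|a m| <= 1) -> `|w n * a j| <= 1.
Proof.
case=> w01 _ ha; rewrite normrM -(mul1r 1) ler_pM //.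
by have /andP[w0 w1] := w01 n; rewrite ger0_norm.
Qed.

(** Insert the number of prime divisors of [n] in [Q] as a weight: it is close to [L] in
mean square, and [Omega (p * m) = Omega m + 1] turns the multiples of [p] up to [N]
into the numbers up to [N / p]. The parameter [s] replaces a square root in the
Cauchy-Schwarz inequality. *)
Lemma turan_kubilius_average (R : realType) (w a : nat -> R) (Q : pred nat)
    (s : R) (i Y N : nat) :
  prime_invariant R w -> (forall m, `|a m| <= 1) ->
  (forall p, Q p -> prime p) -> 0 < s -> (2 * Y <= N)%N ->
  let L : R := \sum_(2 <= p < Y | Q p) p%:R^-1 in
  `|L * wsum R w a i N - \sum_(2 <= p < Y | Q p) wsum R w a i.+1 (N %/ p)|
     <= N%:R * (L / s + s / 2 + 1).
Proof.
move=> hw ha Qp s0 YN; cbv zeta; set L : R := \sum_(2 <= p < Y | Q p) p%:R^-1.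
have L0 : 0 <= L by apply: sumr_ge0 => p _; rewrite invr_ge0.
have [w01 winv] := hw.
set om := fun n : nat => \sum_(2 <= p < Y | Q p) (p %| n)%:R : R.
set f := fun n => w n * a (Omega n + i)%N.
have f1 n : `|f n| <= 1 by exact: weight_term_le1.
have D1 : `|L * wsum R w a i N - \sum_(1 <= n < N.+1) f n * om n|
    <= N%:R * (L / s + s / 2).
  rewrite /wsum mulr_sumr -sumrB.
  apply: (le_trans (ler_norm_sum _ _ _)).
  apply: (@le_trans _ _ (\sum_(1 <= n < N.+1) ((om n - L) ^+ 2 / (2 * s) + s / 2))).
    apply: ler_sum => n _; rewrite -/(f n).
    have -> : L * f n - f n * om n = - (f n * (om n - L)).
      by move: (f n) (om n) L L0 => x y z _; ring.
    rewrite normrN normrM; apply: (@le_trans _ _ (1 * `|om n - L|)).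
      by apply: ler_wpM2r.
    rewrite mul1r -(@real_normK _ (om n - L)) ?num_real //.
    move: (`|om n - L|) => y.
    rewrite -(ler_pM2r (_ : 0 < 2 * s)) ?mulr_gt0 //.
    have -> : (y ^+ 2 / (2 * s) + s / 2) * (2 * s) = y ^+ 2 + s * s.
      by field; rewrite gt_eqF.
    have : 0 <= (y - s) ^+ 2 by exact: sqr_ge0.
    nra.
  rewrite big_split /= sumr_const_nat subn1 /= -mulr_suml -[s / 2 *+ N]mulr_natl [leRHS]mulrDr lerD2r.
  rewrite ler_pdivrMr ?mulr_gt0 //; apply: (le_trans (turan_kubilius _ _ _ _ Qp)).
  rewrite -/L; have -> : N%:R * (L / s) * (2 * s) = 2 * N%:R * L.
    by field; rewrite gt_eqF.
  have : 2 * Y%:R <= N%:R :> R by rewrite -natrM ler_nat.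
  move=> h; have := ler_wpM2r L0 h; lra.
have D2 : `|\sum_(1 <= n < N.+1) f n * om n -
     \sum_(2 <= p < Y | Q p) wsum R w a i.+1 (N %/ p)| <= N%:R * 1.
  have -> : \sum_(1 <= n < N.+1) f n * om n =
     \sum_(2 <= p < Y | Q p) \sum_(1 <= m < (N %/ p).+1) f (p * m)%N.
    under eq_bigr => n _ do rewrite mulr_sumr.
    rewrite exchange_big; apply: eq_bigr => p /Qp/prime_gt0 p0.
    rewrite -sum_multiples // [RHS]big_mkcond; apply: eq_bigr => n _.
    by case: (p %| n)%N; rewrite ?mulr1 ?mulr0.
  rewrite -sumrB; apply: (le_trans (ler_norm_sum _ _ _)).
  apply: le_trans (ler_wpM2l _ (sum_inv_sqr_le1 R Q Y)) => //.
  rewrite mulr_sumr; apply: ler_sum => p /Qp pp; have p0 := prime_gt0 pp.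
  rewrite /wsum -sumrB; apply: (le_trans (ler_norm_sum _ _ _)).
  apply: (@le_trans _ _ (\sum_(1 <= m < (N %/ p).+1 | (p %| m)%N) 1)).
    rewrite [leRHS]big_mkcond /=; apply: ler_sum_nat => m /andP[m0 _].
    rewrite /f Omega_prime_mul //.
    rewrite addSnnS; case: (boolP (p %| m)%N) => pm; last first.
      by rewrite winv // subrr normr0.
    rewrite -mulrBl normrM -(mul1r 1) ler_pM //.
    have := w01 m; have := w01 (p * m)%N; rewrite ler_norml; lra.
  rewrite sum_multiples // sumr_const_nat subn1 /=.
  apply: (le_trans (natr_divn_le _ _ _)); rewrite mulrA ler_wpM2r ?invr_ge0 //.
  exact: natr_divn_le.
rewrite -(subrKA (\sum_(1 <= n < N.+1) f n * om n)) [leRHS]mulrDr.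
by apply: (le_trans (ler_normD _ _)); apply: lerD.
Qed.

Lemma wsum_norm_le (R : realType) (w a : nat -> R) (i x : nat) :
  prime_invariant R w -> (forall m, `|a m| <= 1) -> `|wsum R w a i x| <= x%:R.
Proof.
move=> hw ha; apply: (le_trans (ler_norm_sum _ _ _)).
apply: (@le_trans _ _ (\sum_(1 <= n < x.+1) 1)).
  by apply: ler_sum => n _; apply: weight_term_le1.
by rewrite sumr_const_nat subn1.
Qed.

Lemma wmean_norm_le1 (R : realType) (w a : nat -> R) (i x : nat) :
  prime_invariant R w -> (forall m, `|a m| <= 1) -> `|wmean R w a i x| <= 1.
Proof.
move=> hw ha; rewrite normrM normfV [`|x%:R|]ger0_norm //.
case: (posnP x) => [->|x0]; first by rewrite invr0 mulr0.
by rewrite ler_pdivrMr ?ltr0n // mul1r; apply: wsum_norm_le.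
Qed.

Lemma wsum_wmean (R : realType) (w a : nat -> R) (i x : nat) :
  wsum R w a i x = wmean R w a i x * x%:R.
Proof.
case: (posnP x) => [->|x0]; first by rewrite /wsum big_geq // mulr0.
by rewrite mulfVK // pnatr_eq0 -lt0n.
Qed.

Lemma wmean_slow (R : realType) (w a : nat -> R) (i x y : nat) :
  prime_invariant R w -> (forall m, `|a m| <= 1) -> (0 < x)%N -> (x <= y)%N ->
  `|wmean R w a i x - wmean R w a i y| <= 2 * (1 - x%:R / y%:R).
Proof.
move=> hw ha x0 xy.
have yR : (0 : R) < y%:R by rewrite ltr0n (leq_trans x0).
have d : `|wsum R w a i y - wsum R w a i x| <= y%:R - x%:R.
  rewrite /wsum (@big_cat_nat _ _ _ x.+1 1 y.+1) //= addrAC subrr add0r.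
  apply: (le_trans (ler_norm_sum _ _ _)).
  apply: (@le_trans _ _ (\sum_(x.+1 <= n < y.+1) 1)).
    by apply: ler_sum => n _; apply: weight_term_le1.
  by rewrite sumr_const_nat subSS natrB.
have m1 := wmean_norm_le1 R w a i x hw ha.
rewrite -(ler_pM2r yR) -[X in _ * X <= _](ger0_norm (ltW yR)) -normrM.
have -> : (wmean R w a i x - wmean R w a i y) * y%:R =
   wmean R w a i x * (y%:R - x%:R) - (wsum R w a i y - wsum R w a i x).
  by rewrite !wsum_wmean; ring.
have -> : 2 * (1 - x%:R / y%:R) * y%:R = 2 * (y%:R - x%:R) :> R.
  by field; rewrite gt_eqF.
apply: (le_trans (ler_normB _ _)).
have yx : 0 <= y%:R - x%:R :> R by rewrite subr_ge0 ler_nat.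
rewrite normrM [`|y%:R - x%:R|]ger0_norm //.
have := ler_wpM2r yx m1; lra.
Qed.

(** By [turan_kubilius_average], [L] times the mean at [N] is the [1/p]-weighted sum of the
means at [N / p] up to [O(sqrt L)]; a deficit of [k] at every [p] in [Q] makes this error at
least [k * L], so that [L] is bounded. *)
Lemma exceptional_below (R : realType) (w a : nat -> R) (Q : pred nat) (k : R)
    (i Y N : nat) :
  prime_invariant R w -> (forall m, `|a m| <= 1) ->
  (forall p, Q p -> prime p) -> 0 < k -> (2 * Y <= N)%N -> (1 + k) * Y%:R <= N%:R ->
  (0 < N)%N ->
  (forall p, Q p -> (p < Y)%N -> wmean R w a i.+1 (N %/ p) <= wmean R w a i N - k) ->
  \sum_(2 <= p < Y | Q p) p%:R^-1 <= 2 / k * (k^-1 + 2).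
Proof.
move=> hw ha Qp k0 YN kY N0 bad; set L : R := (\sum_(2 <= p < Y | Q p) p%:R^-1).
have s0 : 0 < 2 / k by rewrite divr_gt0.
have := turan_kubilius_average R w a Q (2 / k) i Y N hw ha Qp s0 YN.
cbv zeta; rewrite -/L; set S := \sum_(2 <= p < Y | Q p) _.
set c := wmean R w a i N - k in bad.
have NR : (0 : R) < N%:R by rewrite ltr0n.
have SL : S <= c * N%:R * L + (1 + k) * Y%:R.
  apply: (@le_trans _ _ (\sum_(2 <= p < Y | Q p) (c * N%:R * p%:R^-1 + (1 + k)))).
    rewrite /S big_seq_cond [leRHS]big_seq_cond; apply: ler_sum => p.
    rewrite mem_index_iota => /andP[/andP[p2 pY] qp].
    rewrite wsum_wmean; apply: (le_trans (ler_wpM2r _ (bad _ qp pY))) => //.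
    have g1 := natr_divn_le R N p.
    have p0 : (0 < p)%N by lia.
    have g2 := natr_divn_ge R N p p0.
    have cb : `|c| <= 1 + k.
      apply: (le_trans (ler_normB _ _)); rewrite [`|k|]gtr0_norm // lerD2r.
      exact: wmean_norm_le1.
    rewrite -mulrA -lerBlDl -mulrBr; apply: (le_trans (ler_norm _)).
    rewrite normrM -[leRHS]mulr1 ler_pM // ler_norml; lra.
  rewrite big_split /= -mulr_sumr lerD2l big_mkcond /=.
  apply: (@le_trans _ _ (\sum_(2 <= p < Y) (1 + k))).
    by apply: ler_sum => p _; case: ifP => _ //; rewrite addr_ge0 // ltW.
  rewrite sumr_const_nat -[_ *+ (Y - 2)]mulr_natr ler_wpM2l ?ler_nat ?leq_subr //.
  by rewrite addr_ge0 // ltW.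
rewrite wsum_wmean ler_norml => /andP[_ h].
have hc : wmean R w a i N = c + k by rewrite /c subrK.
rewrite hc in h.
have e1 : L / (2 / k) = L * k / 2 by field; rewrite gt_eqF.
have e2 : 2 / k / 2 = k^-1 by field; rewrite gt_eqF.
rewrite e1 e2 in h.
have h3 : N%:R * (L * k / 2) <= N%:R * (k^-1 + 2).
  move: h SL kY; move: (k^-1) => k'; move: (N%:R : R) (Y%:R : R) => n y.
  move: S L c {bad hc e1} => S L c; nra.
move: h3; rewrite ler_pM2l // => h3.
have -> : 2 / k * (k^-1 + 2) = (k^-1 + 2) * 2 / k by field; rewrite gt_eqF.
rewrite ler_pdivlMr //; lra.
Qed.

(** [exceptional_below] for [a] and for [- a]. What matters is the order of the quantifiers:
the bound on the mass is independent of [Y], and only the threshold [X] depends on it. *)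
Lemma exceptional_primes (R : realType) (w : nat -> R) (k : R) (Y : nat) :
  prime_invariant R w -> 0 < k ->
  exists X : nat, forall N, (X <= N)%N -> forall (a : nat -> R) (i : nat),
    (forall m, `|a m| <= 1) ->
    pmass R [pred p | k < `|wmean R w a i.+1 (N %/ p) - wmean R w a i N|] Y
      <= 4 / k * (k^-1 + 2).
Proof.
move=> hw k0.
pose X := Num.bound ((1 + k) * Y%:R).
exists (maxn (2 * Y).+1 X) => N; rewrite geq_max => /andP[YN XN] a i ha.
have kY : (1 + k) * Y%:R <= N%:R.
  apply: le_trans (ltW (archi_boundP _)) _; last by rewrite ler_nat.
  by rewrite mulr_ge0 // addr_ge0 // ltW.
pose Q (b : nat -> R) := [pred p | prime p &&
  (wmean R w b i.+1 (N %/ p) <= wmean R w b i N - k)].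
have E (b : nat -> R) : (forall m, `|b m| <= 1) ->
    pmass R (Q b) Y <= 2 / k * (k^-1 + 2).
  move=> hb; apply: (@le_trans _ _ (\sum_(2 <= p < Y | Q b p) p%:R^-1)).
    rewrite /pmass; have [Y2|Y2] := leqP 2 Y; last first.
      rewrite [leRHS]big_geq; last by lia.
      rewrite big1_seq // => p /andP[/andP[pp _]]; rewrite mem_index_iota.
      by have := prime_gt1 pp; lia.
    rewrite (@big_cat_nat _ _ _ 2) //= [X in X + _]big1_seq ?add0r; last first.
      move=> p /andP[/andP[pp _]]; rewrite mem_index_iota.
      by have := prime_gt1 pp; lia.
    rewrite (eq_bigl (Q b)) // => p /=; by case: (prime p).
  apply: (exceptional_below R w b (Q b) k i Y N hw hb) => //; [|lia|lia|].
    by move=> p /andP[].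
  by move=> p /andP[].
have ha' m : `|- a m| <= 1 by rewrite normrN.
have neg j x : wmean R w (fun m => - a m) j x = - wmean R w a j x.
  by rewrite /wmean /wsum; under eq_bigr do rewrite mulrN; rewrite sumrN mulNr.
have -> : 4 / k * (k^-1 + 2) = 2 / k * (k^-1 + 2) + 2 / k * (k^-1 + 2) by ring.
apply: le_trans (lerD (E _ ha) (E _ ha')); apply: le_trans (pmassU _ _ _ _).
apply: pmass_mono => p pp pY /=; rewrite pp !neg /=.
by rewrite lter_normr => /orP[h|h]; apply/orP; [right|left]; lra.
Qed.

(** * Staircases of products of primes *)

Lemma pmass_exists_le (R : realType) (B : nat -> pred nat) (L : R) (j Y : nat) :
  (forall s, (s <= j)%N -> pmass R (B s) Y <= L) ->
  pmass R [pred p | has (fun s => B s p) (iota 0 j.+1)] Y <= j.+1%:R * L.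
Proof.
elim: j => [|j IH] H.
  rewrite mul1r; apply: le_trans (H 0%N (leqnn _)).
  by apply: pmass_mono => p _ _ /=; rewrite orbF.
rewrite -[j.+2%:R]natr1 mulrDl mul1r.
apply: le_trans (lerD (IH (fun s sj => H s (leqW sj))) (H j.+1 (leqnn _))).
apply: le_trans (pmassU _ _ _ _); apply: pmass_mono => p _ _ h.
have {h} : has (fun s => B s p) (iota 0 j.+2) := h.
by rewrite -[j.+2]addn1 iotaD has_cat /= orbF.
Qed.

Lemma divn_large (X Y N r : nat) : (0 < r)%N -> (r <= Y)%N -> (X * Y <= N)%N ->
  (X <= N %/ r)%N.
Proof. by move=> r0 rY h; rewrite leq_divRL //; apply: leq_trans h; rewrite leq_mul2l rY orbT. Qed.

Lemma narrow_pair_scale (e t p q c : nat) :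
  narrow_pair e t p q -> narrow_pair e t (p * c) (q * c) && narrow_pair e t (c * p) (c * q).
Proof.
rewrite /narrow_pair => /andP[h1 h2].
rewrite (mulnC c p) (mulnC c q) !mulnA !leq_mul2r h1 h2 !orbT //.
Qed.

(** The extra factor is [p], except at the new top step where it is [q]; at each stage the
pair is chosen outside the exceptional primes of all the products built so far. *)
Lemma staircase (R : realType) (w : nat -> R) (e t : nat) :
  prime_invariant R w ->
  (forall L : R, exists Y, forall B : pred nat,
    pmass R B Y <= L -> exists p q, [/\ prime p, prime q, ((p < Y) && (q < Y))%N,
     ~~ B p && ~~ B q & narrow_pair e t p q]) ->
  forall (j : nat) (k : R), 0 < k -> exists Y X : nat, forall N, (X <= N)%N ->
    forall (a : nat -> R) (i : nat), (forall m, `|a m| <= 1) ->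
    exists r : nat -> nat,
      (forall s, (s <= j)%N -> [/\ (0 < r s)%N, (r s <= Y)%N &
         `|wmean R w a (i + j) (N %/ r s) - wmean R w a i N| <= k]) /\
      (forall s, (s < j)%N -> narrow_pair e t (r s) (r s.+1)).
Proof.
move=> hw HP; elim=> [|j IH] k k0.
  exists 1%N, 0%N => N _ a i ha; exists (fun => 1%N); split=> // s _.
  by rewrite addn0 divn1 subrr normr0 ltW.
have k2 : 0 < k / 2 by rewrite divr_gt0.
have [Y1 [X1 H1]] := IH _ k2.
set L0 := 4 / (k / 2) * ((k / 2)^-1 + 2).
have [Y2 H2] := HP (j.+1%:R * L0).
have [X2 H3] := exceptional_primes R w _ Y2 hw k2.
exists (Y1 * Y2)%N, (maxn X1 (X2 * Y1)) => N; rewrite geq_max => /andP[NX1 NX2] a i ha.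
have [r [hr hn]] := H1 N NX1 a i ha.
pose B s := [pred p | k / 2 < `|wmean R w a (i + j).+1 ((N %/ r s) %/ p)
                                - wmean R w a (i + j) (N %/ r s)|].
have hB s : (s <= j)%N -> pmass R (B s) Y2 <= L0.
  move=> sj; have [r0 rY _] := hr s sj.
  by apply: H3 => //; apply: divn_large NX2.
have [p [q [pp pq /andP[pY qY] /andP[Bp Bq] np]]] := H2 _ (pmass_exists_le R B L0 j Y2 hB).
have close s x : (s <= j)%N -> ~~ has (fun s => B s x) (iota 0 j.+1) ->
   `|wmean R w a (i + j.+1) (N %/ (r s * x)) - wmean R w a i N| <= k.
  move=> sj /hasPn/(_ s); rewrite mem_iota => /(_ sj) /=; rewrite -leNgt => h.
  have [_ _ h2] := hr s sj; rewrite divnMA addnS.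
  rewrite -(subrKA (wmean R w a (i + j) (N %/ r s))) (splitr k).
  by apply: (le_trans (ler_normD _ _)); apply: lerD.
exists (fun s => if (s <= j)%N then (r s * p)%N else (r j * q)%N); split=> s sj.
  case: (leqP s j) => sj'.
    have [r0 rY _] := hr s sj'; rewrite muln_gt0 r0 prime_gt0 //; split=> //.
      by rewrite leq_mul // ltnW.
    exact: close.
  have [r0 rY _] := hr j (leqnn j); rewrite muln_gt0 r0 prime_gt0 //; split=> //.
    by rewrite leq_mul // ltnW.
  exact: close.
rewrite -ltnS sj; case: (ltnP s j) => sj'.
  by have /andP[] := narrow_pair_scale _ _ _ _ p (hn s sj').
have -> : s = j by lia.
by have /andP[] := narrow_pair_scale _ _ _ _ (r j) np.
Qed.

(** The index is [(i + j).+1] because [P] arises as a product of the [j] primes of a staircase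
and one last prime. *)
Definition hits_scale (R : realType) (w a : nat -> R) (e i j N n : nat) (k : R) : Prop :=
  exists P : nat, [/\ (P <= 16 ^ n)%N, (e * 16 ^ n <= e.+1 * P)%N &
    `|wmean R w a (i + j).+1 (N %/ P) - wmean R w a i N| <= k].

Lemma step_below (f : nat -> nat) (e j T : nat) :
  (forall s, (s < j)%N -> (e * f s.+1 <= e.+1 * f s)%N) ->
  (f 0 <= T)%N -> (T <= f j)%N ->
  exists s, [/\ (s <= j)%N, (f s <= T)%N & (e * T <= e.+1 * f s)%N].
Proof.
elim: j => [|j IH] H f0 fj.
  by exists 0%N; split=> //; apply: leq_mul.
case: (leqP T (f j)) => h.
  have [|s [h1 h2 h3]] := IH _ f0 h; first by move=> s sj; apply: H; apply: leqW.
  by exists s; split=> //; apply: leqW.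
exists j; split; [exact: leqnSn|exact: ltnW|].
by apply: leq_trans (H j (leqnn _)); rewrite leq_mul2l fj orbT.
Qed.

(** Bernoulli's inequality: [15 t] steps of ratio at least [1 + 1/t] climb a factor 16. *)
Lemma expn_ratio_16 (t n : nat) : (0 < t)%N -> (15 * t <= n)%N ->
  (16 * t ^ n <= t.+1 ^ n)%N.
Proof.
move=> t0 tn.
have H m : (t ^ m * (t + m) <= t.+1 ^ m * t)%N.
  elim: m => [|m IH]; first by rewrite addn0.
  rewrite !expnS; move: IH; set X := (t ^ m)%N; set Z := (t.+1 ^ m)%N; nia.
have := H n; set X := (t ^ n)%N; set Z := (t.+1 ^ n)%N => h; nia.
Qed.

(** If the scale [16^n] is missed then every prime [p] in the window
[16^n / 16 < p * r 0 <= 16^n] is exceptional for some step of the staircase, because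
[p * r 0, ..., p * r j] climbs past [16^n] by small steps. Such a window has mass at
least of order [1 / n], whereas the exceptional primes have bounded mass. *)
Lemma most_scales_hit (R : realType) (w : nat -> R) (e : nat) :
  prime_invariant R w -> (0 < e)%N ->
  exists j0, forall j, (j0 <= j)%N -> forall k : R, 0 < k ->
  exists (C : R) (n0 : nat), forall n1 n2, (n0 <= n1)%N -> exists X, forall N, (X <= N)%N ->
    forall (a : nat -> R) (i : nat), (forall m, `|a m| <= 1) ->
    \sum_(n1 <= n < n2 | ~~ `[< hits_scale R w a e i j N n k >]) n.+1%:R^-1 <= C.
Proof.
move=> hw e0; have [t [t0 HP]] := narrow_pairs_exist R e e0.
exists (15 * t)%N => j hj k k0.
have k2 : 0 < k / 2 by rewrite divr_gt0.
have [Y [X1 H1]] := staircase R w e t hw HP j _ k2.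
set L0 := 4 / (k / 2) * ((k / 2)^-1 + 2).
exists (32 * (j.+1%:R * L0)), (Y + 5)%N => n1 n2 n01.
set Y2 := (16 ^ n2).+1.
have [X2 H3] := exceptional_primes R w _ Y2 hw k2.
exists (maxn X1 (X2 * Y)) => N; rewrite geq_max => /andP[NX1 NX2] a i ha.
have [r [hr hn]] := H1 N NX1 a i ha.
pose B s := [pred p | k / 2 < `|wmean R w a (i + j).+1 ((N %/ r s) %/ p)
                                - wmean R w a (i + j) (N %/ r s)|].
have hB s : (s <= j)%N -> pmass R (B s) Y2 <= L0.
  move=> sj; have [r0 rY _] := hr s sj.
  by apply: H3 => //; apply: divn_large NX2.
have := pmass_exists_le R B L0 j Y2 hB; set Bad := [pred p | _] => hBad.
have [r0 rY _] := hr 0%N (leq0n _).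
pose W n := [pred p | (16 ^ n < 16 * (p * r 0))%N && (p * r 0 <= 16 ^ n)%N].
have dis m n p : W m p -> W n p -> m = n.
  have aux b c : W b p -> W c p -> (b <= c)%N.
    move=> /andP[h1 _] /andP[_ h2].
    have : (16 ^ b < 16 ^ c.+1)%N.
      by apply: leq_trans h1 _; rewrite expnS leq_mul2l h2 orbT.
    by rewrite ltn_exp2l.
  by move=> h1 h2; apply/eqP; rewrite eqn_leq aux // aux.
pose D n := ~~ `[< hits_scale R w a e i j N n k >].
have := @pmass_disjoint R Bad W D n1 n2 Y2 dis => hdis.
rewrite -ler_pdivrMl //; apply: le_trans hBad; apply: le_trans hdis.
rewrite mulr_sumr big_seq_cond [leRHS]big_seq_cond; apply: ler_sum => n /andP[].
rewrite mem_index_iota => /andP[nn1 nn2] /asboolPn nhit.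
apply: (@le_trans _ _ (pmass R (W n) Y2)); last first.
  apply: pmass_mono => p pp pY Wp; apply/andP; split=> //.
  apply: contraPT nhit => nB; move: Wp => /andP[lo hi].
  have step s : (s < j)%N -> (e * (p * r s.+1) <= e.+1 * (p * r s))%N.
    by move=> /hn/(narrow_pair_scale _ _ _ _ p)/andP[_ /andP[]].
  have grow s : (s <= j)%N -> (t.+1 ^ s * r 0 <= t ^ s * r s)%N.
    elim: s => [|s IH] sj //; have {}IH := IH (ltnW sj).
    have /andP[h _] := hn s sj.
    rewrite !expnS -mulnA; apply: (@leq_trans (t ^ s * (t.+1 * r s))).
      by rewrite (mulnCA (t ^ s)%N) leq_mul2l IH orbT.
    by rewrite -mulnA (mulnCA t) leq_mul2l h orbT.
  have top : (16 ^ n <= p * r j)%N.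
    apply: (leq_trans (ltnW lo)); rewrite mulnCA leq_mul2l; apply/orP; right.
    rewrite -(@leq_pmul2l (t ^ j)) ?expn_gt0 ?t0 //.
    apply: leq_trans (grow j (leqnn _)); rewrite mulnA leq_mul2r mulnC.
    by rewrite expn_ratio_16 ?orbT.
  have [s [sj f1 f2]] := step_below (fun s => p * r s)%N e j _ step hi top.
  suff : hits_scale R w a e i j N n k by move=> hit; apply.
  exists (p * r s)%N; split=> //.
  have {}nB : ~~ has (fun s => B s p) (iota 0 j.+1) := nB.
  move: nB => /hasPn/(_ s); rewrite mem_iota => /(_ sj) /=; rewrite -leNgt => h.
  have [_ _ h2] := hr s sj; rewrite (mulnC p) divnMA.
  rewrite -(subrKA (wmean R w a (i + j) (N %/ r s))) (splitr k).
  by apply: (le_trans (ler_normD _ _)); apply: lerD.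
(* The dyadic window used is [(2^l, 2^(l+3)]], with [2^c] the power of 2 just above
   [r 0]; replacing [r 0] by [2^c] loses a factor 2, whence the ratio 16. *)
set c := (trunc_log 2 (r 0)).+1.
have /andP[c1 c2] := trunc_log_bounds (isT : (1 < 2)%N) r0; rewrite -/c in c2.
have cY : (c <= Y.+1)%N.
  by rewrite ltnS; apply: leq_trans rY; apply: leq_trans c1; apply/ltnW/ltn_expl.
set l := (4 * n - 3 - c)%N.
have l12 : (12 <= l)%N by rewrite /l; lia.
have e16 m : (16 ^ m = 2 ^ (4 * m))%N by rewrite expnM.
have el : (l + 3 + c = 4 * n)%N by rewrite /l; lia.
have lY : (2 ^ (l + 3) < Y2)%N.
  rewrite ltnS e16 leq_exp2l //; lia.
apply: le_trans (_ : (8 * (l + 3))%:R^-1 <= _).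
  rewrite -invfM -natrM lef_pV2 ?posrE ?ltr0n ?ler_nat //; lia.
apply: (le_trans (pmass_window R _ _ l12 lY)); apply: pmass_mono => p pp pY /= /andP[h1 h2].
have E1 : (16 ^ n = 2 ^ (l + 3) * 2 ^ c)%N by rewrite e16 -expnD el.
have E2 : (2 ^ (l + 3) = 2 ^ l * 8)%N by rewrite expnD.
have E3 : (2 ^ c = 2 * 2 ^ trunc_log 2 (r 0))%N by rewrite expnS.
rewrite E1; move: h1 h2 c1 c2; rewrite E2 E3.
set A := (2 ^ l)%N; set b := (2 ^ _)%N; clear; nia.
Qed.

(** * Invariance under the shift *)

(** Two families of scales of bounded harmonic measure cannot cover an interval of large
harmonic measure. So a common scale is hit from index 0 with [J + 2] primes and
from index 1 with [J + 1] primes, and both means at [N] are compared with means of index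
[J + 2] at nearby points. The bound is uniform in [a], as the application to [k]-full
numbers requires. *)
Theorem wmean_shift_invariant (R : realType) (w : nat -> R) (eps : R) :
  prime_invariant R w -> 0 < eps ->
  exists X : nat, forall N, (X <= N)%N -> forall a : nat -> R,
    (forall m, `|a m| <= 1) -> `|wmean R w a 0 N - wmean R w a 1 N| <= eps.
Proof.
move=> hw eps0.
pose e := (Num.bound (8 / eps)).+1.
have he : e.+1%:R^-1 <= eps / 8 :> R.
  rewrite -[leRHS]invrK lef_pV2 ?posrE ?invr_gt0 ?ltr0n ?divr_gt0 // invf_div.
  have b0 : 0 <= 8 / eps by rewrite divr_ge0 // ltW.
  apply: le_trans (ltW (archi_boundP b0)) _.
  by rewrite ler_nat /e; lia.
have k0 : 0 < eps / 4 by rewrite divr_gt0.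
have [J HJ] := most_scales_hit R w e hw isT.
have [C1 [m1 H1]] := HJ J.+1 (leqnSn _) _ k0.
have [C2 [m2 H2]] := HJ J (leqnn _) _ k0.
set m := maxn m1 m2.
have [n2 hn2] := harmonic_unbounded R m (C1 + C2).
have [X1 {}H1] := H1 m n2 (leq_maxl _ _).
have [X2 {}H2] := H2 m n2 (leq_maxr _ _).
pose X3 := Num.bound (8 / eps * (16 ^ n2)%:R).
exists (maxn X1 (maxn X2 (maxn X3 (16 ^ n2)))) => N; rewrite !geq_max.
move=> /and4P[NX1 NX2 NX3 N16] a ha.
have {}H1 := H1 N NX1 a 0%N ha; have {}H2 := H2 N NX2 a 1%N ha.
have [n [nn2 h1 h2]] : exists n, [/\ (n < n2)%N, hits_scale R w a e 0 J.+1 N n (eps / 4)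
     & hits_scale R w a e 1 J N n (eps / 4)].
  apply: contrapT => no; suff : \sum_(m <= j < n2) j.+1%:R^-1 <= C1 + C2 by lra.
  apply: le_trans (lerD H1 H2).
  rewrite [X in _ <= X + _]big_mkcond [X in _ <= _ + X]big_mkcond -big_split /=.
  apply: ler_sum_nat => n /andP[_ nn2].
  have p0 : 0 <= n.+1%:R^-1 :> R by rewrite invr_ge0.
  move: (n.+1%:R^-1 : R) p0 => z z0.
  case: asboolP => g1 /=; last by case: ifP => _; lra.
  case: asboolP => g2 /=; last by lra.
  by case: no; exists n.
have [P [P1 P2 PP]] := h1; have [Q [Q1 Q2 QQ]] := h2.
have N0 : (0 < N)%N by apply: leq_trans N16; rewrite expn_gt0.
have NR : (0 : R) < N%:R by rewrite ltr0n.
have T0 : (0 < 16 ^ n)%N by rewrite expn_gt0.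
have TN : (16 ^ n <= N)%N by apply: leq_trans N16; rewrite leq_exp2l // ltnW.
have TNR : (16 ^ n)%:R <= eps / 8 * N%:R.
  apply: (@le_trans _ _ (16 ^ n2)%:R); first by rewrite ler_nat leq_exp2l // ltnW.
  rewrite -ler_pdivrMl ?divr_gt0 // invf_div.
  apply: le_trans (ltW (archi_boundP _)) _; last by rewrite ler_nat; exact: NX3.
  by rewrite mulr_ge0 // divr_ge0 // ltW.
have slow A B : (A <= 16 ^ n)%N -> (B <= 16 ^ n)%N ->
   (e * 16 ^ n <= e.+1 * A)%N -> (e * 16 ^ n <= e.+1 * B)%N -> (B <= A)%N ->
   `|wmean R w a J.+2 (N %/ A) - wmean R w a J.+2 (N %/ B)| <= eps / 2.
  move=> A1 B1 A2 B2 BA.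
  have A0 : (0 < A)%N by nia.
  have B0 : (0 < B)%N by nia.
  have x0 : (0 < N %/ A)%N by rewrite divn_gt0 // (leq_trans A1).
  have xy : (N %/ A <= N %/ B)%N by apply: leq_div2l.
  apply: (le_trans (wmean_slow R w a _ _ _ hw ha x0 xy)).
  have yR : (0 : R) < (N %/ B)%:R by rewrite ltr0n (leq_trans x0).
  have g1 := natr_divn_ge R N A A0; have g2 := natr_divn_le R N B.
  have AR : (0 : R) < A%:R by rewrite ltr0n.
  have BR : (0 : R) < B%:R by rewrite ltr0n.
  suff : (1 - e.+1%:R^-1 - eps / 8) * (N %/ B)%:R <= (N %/ A)%:R.
    rewrite -ler_pdivlMr //; move: he; move: (e.+1%:R^-1 : R) => f hf; lra.
  set x := (N %/ A)%:R in g1 *; set y := (N %/ B)%:R in g2 yR *.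
  have TR : (0 : R) < (16 ^ n)%:R by rewrite ltr0n.
  have z1 : N%:R / (16 ^ n)%:R <= N%:R / A%:R :> R.
    by rewrite ler_pM2l // lef_pV2 ?posrE // ler_nat.
  have z2 : N%:R / (16 ^ n)%:R <= N%:R / B%:R :> R.
    by rewrite ler_pM2l // lef_pV2 ?posrE // ler_nat.
  have z3 : N%:R / B%:R * (1 - e.+1%:R^-1) <= N%:R / (16 ^ n)%:R :> R.
    have eR : (0 : R) < e.+1%:R by rewrite ltr0n.
    have -> : 1 - e.+1%:R^-1 = e%:R / e.+1%:R :> R.
      by rewrite -[e%:R in RHS](addrK 1) natr1 mulrBl divff ?mul1r // gt_eqF.
    rewrite -mulrA ler_pM2l // ler_pdivrMl // ler_pdivrMr // mulrAC ler_pdivlMr //.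
    by rewrite -!natrM ler_nat mulnC [leqRHS]mulnC mulnC.
  have z4 : 1 <= eps / 8 * (N%:R / (16 ^ n)%:R).
    by rewrite mulrA ler_pdivlMr // mul1r.
  have x0' : 0 <= x by [].
  set u := N%:R / B%:R in g2 z2 z3; set v := N%:R / A%:R in g1 z1.
  set z := N%:R / (16 ^ n)%:R in z1 z2 z3 z4.
  have [f0|f0] := leP 0 (1 - e.+1%:R^-1 - eps / 8); last first.
    by apply: le_trans x0'; rewrite mulr_le0_ge0 // ltW.
  apply: (@le_trans _ _ ((1 - e.+1%:R^-1 - eps / 8) * u)); first by rewrite ler_wpM2l.
  have e8 : 0 <= eps / 8 by rewrite divr_ge0 // ltW.
  have z5 := ler_wpM2l e8 z2; move: z3; move: (e.+1%:R^-1 : R) => f z3; lra.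
have tri (x y c1 c2 : R) : `|c1 - x| <= eps / 4 -> `|c2 - y| <= eps / 4 ->
    `|c1 - c2| <= eps / 2 -> `|x - y| <= eps.
  by rewrite !ler_norml => /andP[? ?] /andP[? ?] /andP[? ?]; lra.
apply: (tri _ _ _ _ PP QQ).
by case: (leqP Q P) => [PQ|/ltnW QP]; [|rewrite distrC]; apply: slow.
Qed.

(** * Decomposition of the k-full numbers *)

Definition from_exponents (B : nat) (g : nat -> nat) : nat :=
  (\prod_(0 <= p < B | prime p) p ^ g p)%N.

Lemma from_exponents_gt0 (B : nat) (g : nat -> nat) : (0 < from_exponents B g)%N.
Proof. by apply: prodn_cond_gt0 => p /prime_gt0 p0; rewrite expn_gt0 p0. Qed.

Lemma logn_from_exponents (B : nat) (g : nat -> nat) (q : nat) : prime q ->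
  logn q (from_exponents B g) = if (q < B)%N then g q else 0%N.
Proof.
move=> pq; elim: B => [|B IH]; first by rewrite /from_exponents big_geq // logn1.
have -> : from_exponents B.+1 g =
    ((if prime B then B ^ g B else 1) * from_exponents B g)%N.
  by rewrite /from_exponents big_mkcond big_nat_recr //= -big_mkcond mulnC.
rewrite lognM ?from_exponents_gt0 ?IH //; last first.
  by case: ifP => // /prime_gt0 B0; rewrite expn_gt0 B0.
rewrite ltnS [X in _ = if X then _ else _]leq_eqVlt.
case: (eqVneq q B) => [<-|qB] /=.
  by rewrite pq ltnn addn0 pfactorK.
case: ifP => [pB|_]; last by rewrite logn1.
by rewrite lognX logn_prime // (negPf qB) muln0.
Qed.

Lemma logn_small (q n : nat) : (n < q)%N -> logn q n = 0%N.
Proof.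
case: (posnP n) => [->|n0] nq; first by rewrite logn0.
apply/eqP; rewrite -leqn0 leqNgt logn_gt0 mem_primes n0 /=.
by apply/negP => /andP[_ /(dvdn_leq n0)]; rewrite leqNgt nq.
Qed.

Lemma eq_from_prime_log (m n : nat) : (0 < m)%N -> (0 < n)%N ->
  (forall p, prime p -> logn p m = logn p n) -> m = n.
Proof.
move=> m0 n0 H; apply: eqn_from_log => // p.
by case: (boolP (prime p)) => pp; [exact: H | rewrite /logn (negPf pp)].
Qed.

Lemma kfull_logn (k n : nat) : (0 < k)%N -> (0 < n)%N ->
  (kfull k n <-> forall p, prime p -> logn p n = 0%N \/ (k <= logn p n)%N).
Proof.
move=> k0 n0; split=> H p pp.
  case: (posnP (logn p n)) => [->|]; [by left|right].
  by rewrite -pfactor_dvdn //; apply: H => //; rewrite -(expn1 p) pfactor_dvdn.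
rewrite -{1}(expn1 p) !pfactor_dvdn //; case: (H p pp) => [->|] //.
Qed.

(** The exponent in [k + 1, ..., 2k - 1], or 0, with the same residue modulo [k]: what
remains of an admissible exponent after extracting as many [k]-th powers as
possible while staying [k]-full. *)
Definition core_exponent (k e : nat) : nat :=
  if (e %% k == 0)%N then 0%N else (k + e %% k)%N.

Definition kfull_core (k n : nat) : nat :=
  from_exponents n.+1 (fun p => core_exponent k (logn p n)).

Lemma kfull_core_gt0 (k n : nat) : (0 < kfull_core k n)%N.
Proof. exact: from_exponents_gt0. Qed.

Lemma logn_kfull_core (k n p : nat) : prime p ->
  logn p (kfull_core k n) = core_exponent k (logn p n).
Proof.
move=> pp; rewrite logn_from_exponents // ltnS; case: leqP => // np.
by rewrite logn_small // /core_exponent mod0n.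
Qed.

Lemma core_exponentK (k e : nat) : core_exponent k (core_exponent k e) = core_exponent k e.
Proof.
rewrite /core_exponent; case: (boolP (e %% k == 0)%N) => h; first by rewrite mod0n.
by rewrite modnDl modn_mod (negPf h).
Qed.

Lemma core_exponentD (k m e : nat) : core_exponent k (k * m + e) = core_exponent k e.
Proof. by rewrite /core_exponent mulnC modnMDl. Qed.

Definition is_core (k b : nat) : bool :=
  `[< kfull k b >] && (kfull_core k b == b).

Lemma kfull_core_is_core (k n : nat) : (0 < k)%N -> is_core k (kfull_core k n).
Proof.
move=> k0; apply/andP; split.
  apply/asboolP/kfull_logn => //; first exact: kfull_core_gt0.
  move=> p pp; rewrite logn_kfull_core // /core_exponent.
  by case: ifP => _; [left|right; rewrite leq_addr].
apply/eqP; apply: eq_from_prime_log; rewrite ?kfull_core_gt0 // => p pp.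
by rewrite !logn_kfull_core // core_exponentK.
Qed.

Lemma kfull_core_pow_mul (k m b : nat) : (0 < k)%N -> (0 < m)%N -> (0 < b)%N ->
  is_core k b -> kfull k (m ^ k * b) /\ kfull_core k (m ^ k * b) = b.
Proof.
move=> k0 m0 b0 /andP[/asboolP hb /eqP cb].
have mb : (0 < m ^ k * b)%N by rewrite muln_gt0 expn_gt0 m0.
have E p : logn p (m ^ k * b) = (k * logn p m + logn p b)%N.
  by rewrite lognM ?expn_gt0 ?m0 // lognX.
split.
  apply/kfull_logn => // p pp; rewrite E.
  have [->|h] := (kfull_logn k b k0 b0).1 hb p pp; last by right; lia.
  by case: (posnP (logn p m)) => [->|h]; [left; rewrite muln0|right; nia].
apply: eq_from_prime_log => //; first exact: kfull_core_gt0.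
by move=> p pp; rewrite logn_kfull_core // E core_exponentD -logn_kfull_core // cb.
Qed.

Lemma core_exponent_split (k v : nat) : (0 < k)%N -> v = 0%N \/ (k <= v)%N ->
  v = (k * ((v - core_exponent k v) %/ k) + core_exponent k v)%N.
Proof.
move=> k0 hv; have ev := divn_eq v k; rewrite /core_exponent; case: eqP => [h|h].
  by rewrite subn0 addn0 {1}ev h addn0 mulnC.
have k1 : (0 < v %/ k)%N.
  by rewrite divn_gt0 //; case: hv => // v0; case: h; rewrite v0 mod0n.
move: ev k1 {h hv}; move: (v %% k)%N => r; case: (v %/ k)%N => // q ev _.
have -> : (v - (k + r) = q * k)%N by rewrite ev mulSn; lia.
by rewrite mulnK // ev mulSn; lia.
Qed.

Lemma kfull_core_decomp (k n : nat) : (0 < k)%N -> (0 < n)%N -> kfull k n ->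
  exists2 m, (0 < m)%N & n = (m ^ k * kfull_core k n)%N.
Proof.
move=> k0 n0 hn.
exists (from_exponents n.+1 (fun p => (logn p n - core_exponent k (logn p n)) %/ k)%N).
  exact: from_exponents_gt0.
have c0 := kfull_core_gt0 k n.
apply: eq_from_prime_log => //; first by rewrite muln_gt0 expn_gt0 from_exponents_gt0.
move=> p pp; rewrite lognM ?expn_gt0 ?from_exponents_gt0 // lognX.
rewrite logn_kfull_core // logn_from_exponents // ltnS.
case: leqP => [pn|np]; last by rewrite logn_small // /core_exponent mod0n muln0.
by apply: core_exponent_split => //; apply: (kfull_logn k n k0 n0).1.
Qed.

(** * Convergence of the sum over the cores *)

(** [x^(-1/k)], with value 0 at 0. *)
Definition root_inv (R : realType) (k x : nat) : R := (x%:R `^ k%:R^-1)^-1.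

Lemma root_inv_ge0 (R : realType) (k x : nat) : 0 <= root_inv R k x.
Proof. by rewrite invr_ge0 powR_ge0. Qed.

Lemma root_invM (R : realType) (k x y : nat) :
  root_inv R k (x * y) = root_inv R k x * root_inv R k y.
Proof. by rewrite /root_inv natrM powRM // invfM. Qed.

Lemma root_inv1 (R : realType) (k : nat) : root_inv R k 1 = 1.
Proof. by rewrite /root_inv powR1 invr1. Qed.

Lemma root_inv0 (R : realType) (k : nat) : (0 < k)%N -> root_inv R k 0 = 0.
Proof.
by move=> k0; rewrite /root_inv powR0 ?invr0 // invr_eq0 pnatr_eq0 -lt0n.
Qed.

Lemma root_inv_exp (R : realType) (k x : nat) : (0 < k)%N ->
  root_inv R k x ^+ k = x%:R^-1.
Proof.
move=> k0; rewrite /root_inv exprVn -powR_mulrn ?powR_ge0 // -powRrM mulVf.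
  by rewrite powRr1.
by rewrite pnatr_eq0 -lt0n.
Qed.

Lemma root_invX (R : realType) (k x n : nat) :
  root_inv R k (x ^ n) = root_inv R k x ^+ n.
Proof.
elim: n => [|n IH]; first by rewrite expn0 expr0 root_inv1.
by rewrite expnS exprS root_invM IH.
Qed.

Lemma root_inv_le (R : realType) (k x y : nat) : (0 < x)%N -> (x <= y)%N ->
  root_inv R k y <= root_inv R k x.
Proof.
move=> x0 xy; rewrite /root_inv lef_pV2 ?posrE ?powR_gt0 ?ltr0n //; last exact: leq_trans xy.
by apply: ge0_ler_powR; rewrite ?nnegrE ?invr_ge0 ?ler_nat.
Qed.

Lemma subrXX_le (R : realType) (u v : R) (n : nat) : 0 <= u -> u <= v ->
  v ^+ n.+1 - u ^+ n.+1 <= n.+1%:R * (v ^+ n * (v - u)).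
Proof.
move=> u0 uv; have v0 := le_trans u0 uv.
elim: n => [|n IH]; first by rewrite !expr1 expr0 !mul1r.
have -> : v ^+ n.+2 - u ^+ n.+2 = v * (v ^+ n.+1 - u ^+ n.+1) + (v - u) * u ^+ n.+1.
  by rewrite !exprS; ring.
rewrite -[n.+2%:R]natr1 [leRHS]mulrDl mul1r; apply: lerD.
  by apply: (le_trans (ler_wpM2l v0 IH)); rewrite mulrCA (exprS v n) -[v * v ^+ n * _]mulrA.
rewrite mulrC ler_wpM2r ?subr_ge0 // ler_pXn2r ?nnegrE //.
Qed.

(** Here [x^(-1-1/k)] is summed. With [u = x^(-1/k)] and [v = (x-1)^(-1/k)] one has
[v^k - u^k = u^k * v^k], so [subrXX_le] gives [u^(k+1) <= k * (v - u)], and the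
right-hand side telescopes. *)
Lemma sum_root_inv_le (R : realType) (k X : nat) : (0 < k)%N ->
  \sum_(0 <= x < X.+1) root_inv R k x ^+ k.+1 <= k.+1%:R.
Proof.
move=> k0.
suff H n : \sum_(0 <= x < n.+2) root_inv R k x ^+ k.+1
     <= 1 + k%:R * (1 - root_inv R k n.+1).
  case: X => [|n].
    by rewrite big_nat1 root_inv0 // exprS mul0r.
  apply: (le_trans (H n)); rewrite -natr1 addrC lerD2r -[leRHS]mulr1.
  by rewrite ler_wpM2l // lerBlDr lerDl root_inv_ge0.
elim: n => [|n IH].
  by rewrite !big_nat_recl // big_geq // root_inv0 // root_inv1 exprS mul0r expr1n subrr; lra.
rewrite big_nat_recr //=; apply: (le_trans (lerD IH (lexx _))).
set v := root_inv R k n.+1; set u := root_inv R k n.+2.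
have u0 : 0 < u by rewrite invr_gt0 powR_gt0.
have v0 : 0 < v by rewrite invr_gt0 powR_gt0.
have uv : u <= v by apply: root_inv_le.
have h : u ^+ k.+1 <= k%:R * (v - u).
  have vk : v ^+ k = n.+1%:R^-1 by rewrite root_inv_exp.
  have uk : u ^+ k = n.+2%:R^-1 by rewrite root_inv_exp.
  have e : v ^+ k - u ^+ k = u ^+ k * v ^+ k.
    rewrite vk uk -[n.+2%:R]natr1; have : (0 : R) < n.+1%:R by rewrite ltr0n.
    by move: (n.+1%:R : R) => z z0; field; rewrite !gt_eqF // addr_gt0.
  case: k k0 @v @u u0 v0 uv {IH vk uk} e => // k _ v u u0 v0 uv e.
  have := subrXX_le R u v k (ltW u0) uv; rewrite e.
  have vk0 : 0 < v ^+ k by rewrite exprn_gt0.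
  have -> : u ^+ k.+1 * v ^+ k.+1 = v ^+ k * (u ^+ k.+1 * v) by rewrite (exprS v); ring.
  have -> : k.+1%:R * (v ^+ k * (v - u)) = v ^+ k * (k.+1%:R * (v - u)) by ring.
  rewrite ler_pM2l // => h1; apply: le_trans h1.
  by rewrite exprSr ler_wpM2l // exprn_ge0 // ltW.
move: h; lra.
Qed.

(** Product of the primes occurring in [b] with exponent exactly [k + j + 1]. *)
Definition core_part (k b j : nat) : nat :=
  from_exponents b.+1 (fun p => logn p b == (k + j.+1)%N).

Lemma logn_prod (I : finType) (F : I -> nat) (p : nat) : (forall i, 0 < F i)%N ->
  logn p (\prod_i F i) = (\sum_i logn p (F i))%N.
Proof.
move=> F0; suff [] : (0 < \prod_i F i)%N /\ logn p (\prod_i F i) = (\sum_i logn p (F i))%N by [].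
elim/big_ind2: _ => [|x1 y1 x2 y2 [h1 e1] [h2 e2]|i _] //; first by rewrite logn1.
by rewrite muln_gt0 h1 h2 lognM // e1 e2.
Qed.

Lemma core_factorization (k b : nat) : (0 < k)%N -> (0 < b)%N -> is_core k b ->
  b = (\prod_(j < k.-1) core_part k b j ^ (k + j.+1))%N.
Proof.
move=> k0 b0 /andP[_ /eqP cb].
have part0 j : (0 < core_part k b j)%N by exact: from_exponents_gt0.
apply: eq_from_prime_log => //.
  by apply: prodn_gt0 => j; rewrite expn_gt0 part0.
move=> p pp; rewrite logn_prod => [|j]; last by rewrite expn_gt0 part0.
have E (j : nat) : logn p (core_part k b j ^ (k + j.+1)) =
    ((k + j.+1) * (logn p b == (k + j.+1)%N))%N.
  rewrite lognX /core_part logn_from_exponents // ltnS.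
  by case: leqP => // h; rewrite logn_small // ?addnS.
under eq_bigr => j _ do rewrite E.
have ev : logn p b = core_exponent k (logn p b) by rewrite -logn_kfull_core // cb.
set v := logn p b in ev *.
move: ev; rewrite /core_exponent; case: eqP => [_ ->|/eqP r0 ev].
  by rewrite big1 // => j _; rewrite addnS muln0.
set r := (v %% k)%N in r0 ev; have rk : (r < k)%N by rewrite ltn_mod.
have rj : (r.-1 < k.-1)%N by lia.
rewrite (bigD1 (Ordinal rj)) //= big1 ?addn0 => [|j jr].
  by rewrite prednK ?lt0n // -ev eqxx muln1.
rewrite (_ : (v == _) = false) ?muln0 //; apply: contraNF jr => /eqP vj.
by apply/eqP/val_inj => /=; lia.
Qed.

(** A core is determined by its [k - 1] parts, and [b^(-1/k)] is at most the product of
the [x^(-(k+1)/k)] over the parts [x]; so the sum is at most the [k - 1]-st power of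
the convergent series of [sum_root_inv_le]. *)
Lemma sum_root_inv_core_le (R : realType) (k X : nat) : (0 < k)%N ->
  \sum_(0 <= b < X.+1 | is_core k b) root_inv R k b <= k.+1%:R ^+ k.-1.
Proof.
move=> k0; rewrite big_mkord.
have core_gt0 b : is_core k b -> (0 < b)%N.
  by case/andP=> _ /eqP <-; apply: kfull_core_gt0.
have part0 b j : (0 < core_part k b j)%N by exact: from_exponents_gt0.
pose h (b : 'I_X.+1) : {ffun 'I_k.-1 -> 'I_X.+1} := [ffun j : 'I_k.-1 => inord (core_part k b j)].
have hE (b : 'I_X.+1) j : is_core k b -> h b j = core_part k b j :> nat.
  move=> cb; have b0 := core_gt0 _ cb; rewrite ffunE inordK // ltnS.
  apply: leq_trans (_ : b <= X)%N; last by rewrite -ltnS.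
  rewrite [X in (_ <= X)%N](core_factorization k b k0 b0 cb) (bigD1 j) //=.
  apply: (@leq_trans (core_part k b j ^ (k + j.+1))).
    by rewrite -{1}(expn1 (core_part k b j)) leq_pexp2l // addnS.
  by apply: leq_pmulr; apply: prodn_gt0 => i; rewrite expn_gt0 part0.
pose G (f : {ffun 'I_k.-1 -> 'I_X.+1}) : R := \prod_j root_inv R k (f j) ^+ k.+1.
have G0 f : 0 <= G f by apply: prodr_ge0 => j _; rewrite exprn_ge0 // root_inv_ge0.
apply: (@le_trans _ _ (\sum_(b in [pred b : 'I_X.+1 | is_core k b]) G (h b))).
  apply: ler_sum => b cb; have b0 := core_gt0 _ cb.
  rewrite {1}(core_factorization k b k0 b0 cb).
  rewrite (big_morph (root_inv R k) (root_invM R k) (root_inv1 R k)) /G.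
  apply: ler_prod => j _; rewrite root_inv_ge0 root_invX hE //= addnS ler_wiXn2l ?root_inv_ge0 //.
    by rewrite -(root_inv1 R k) root_inv_le.
  by rewrite ltnS leq_addr.
rewrite -(@big_imset _ _ _ _ _ h) /=; last first.
  move=> b c; rewrite !inE => cb cc hbc; apply: val_inj.
  rewrite /= (core_factorization k b k0 (core_gt0 _ cb) cb).
  rewrite [RHS](core_factorization k c k0 (core_gt0 _ cc) cc).
  by apply: eq_bigr => j _; rewrite -!hE // hbc.
apply: (@le_trans _ _ (\sum_f G f)).
  by rewrite big_mkcond; apply: ler_sum => f _; case: ifP.
rewrite /G -(bigA_distr_bigA (fun _ x => root_inv R k (nat_of_ord x) ^+ k.+1)).
apply: (@le_trans _ _ (\prod_(j < k.-1) k.+1%:R)); last first.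
  by rewrite prodr_const card_ord.
apply: ler_prod => j _; apply/andP; split.
  by apply: sumr_ge0 => x _; rewrite exprn_ge0 // root_inv_ge0.
by rewrite -(big_mkord xpredT (fun x => root_inv R k x ^+ k.+1)) sum_root_inv_le.
Qed.

(** * The k-full numbers *)

Lemma core_fiber_sum (V : nmodType) (k b N : nat) : (0 < k)%N -> (0 < b)%N ->
  is_core k b -> exists x, (forall m, (m ^ k * b <= N)%N = (m <= x)%N) /\
  forall F : nat -> V,
    \sum_(1 <= n < N.+1 | `[< kfull k n >] && (kfull_core k n == b)) F n =
    \sum_(1 <= m < x.+1) F (m ^ k * b)%N.
Proof.
move=> k0 b0 cb.
have ex0 : exists m, (m ^ k * b <= N)%N by exists 0%N; rewrite exp0n.
have bnd m : (m ^ k * b <= N)%N -> (m <= N)%N.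
  apply: leq_trans; apply: (@leq_trans (m ^ k)); last by rewrite leq_pmulr.
  case: (posnP m) => [->|m0] //.
  by rewrite -{1}(expn1 m) leq_pexp2l.
case: (ex_maxnP ex0 bnd) => x hx mx.
have hE m : (m ^ k * b <= N)%N = (m <= x)%N.
  apply/idP/idP => [/mx//|mx']; apply: leq_trans hx.
  by rewrite leq_mul2r leq_exp2r // mx' orbT.
exists x; split=> // F.
rewrite -big_filter -(big_map (fun m => m ^ k * b)%N xpredT F).
apply: perm_big; apply: uniq_perm.
- by rewrite filter_uniq // iota_uniq.
- rewrite map_inj_uniq ?iota_uniq // => m m' /eqP.
  by rewrite eqn_pmul2r // eqn_exp2r // => /eqP.
move=> n; rewrite mem_filter mem_index_iota ltnS; apply/idP/mapP.
  case/andP=> /andP[/asboolP fn /eqP cn] /andP[n0 nN].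
  have [m m0 em] := kfull_core_decomp k n k0 n0 fn.
  exists m; last by rewrite {1}em cn.
  by rewrite mem_index_iota m0 ltnS -hE -cn -em.
case=> m; rewrite mem_index_iota ltnS -hE => /andP[m0 mN] ->.
have [h1 h2] := kfull_core_pow_mul k m b k0 m0 b0 cb.
by rewrite h2 eqxx mN muln_gt0 expn_gt0 m0 b0 !andbT; apply/asboolP.
Qed.

Lemma core_sum_tail (R : realType) (k : nat) (eps : R) : (0 < k)%N -> 0 < eps ->
  exists M0, forall M N, (M0 <= M)%N -> (M <= N)%N ->
    \sum_(M.+1 <= b < N.+1 | is_core k b) root_inv R k b <= eps.
Proof.
move=> k0 e0; pose U n := \sum_(0 <= b < n.+1 | is_core k b) root_inv R k b.
have Umono : nondecreasing_seq U.
  apply/nondecreasing_seqP => n; rewrite /U [leRHS]big_mkcond big_nat_recr //=.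
  by rewrite -big_mkcond lerDl; case: ifP => // _; exact: root_inv_ge0.
have Ucvg : cvgn U.
  apply: nondecreasing_is_cvgn => //; exists (k.+1%:R ^+ k.-1) => _ [n _ <-].
  exact: sum_root_inv_core_le.
have /cvgrPdist_lt/(_ eps e0) [M0 _ hM0] := Ucvg.
exists M0 => M N MM MN.
have h := hM0 M MM; have hN := nondecreasing_cvgn_le Umono Ucvg N.
have -> : \sum_(M.+1 <= b < N.+1 | is_core k b) root_inv R k b = U N - U M.
  by rewrite /U (@big_cat_nat _ _ _ M.+1 0 N.+1) //= addrAC subrr add0r.
move: h; rewrite /= ltr_norml => /andP[_]; rewrite -/(U M); lra.
Qed.

Lemma prime_invariant1 (R : realType) : prime_invariant R (fun=> 1).
Proof. by split=> // n; rewrite ler01 lexx. Qed.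

Lemma wsum_shift_invariant (R : realType) (w : nat -> R) (eps : R) :
  prime_invariant R w -> 0 < eps ->
  exists X : nat, forall N, (X <= N)%N -> forall a : nat -> R,
    (forall m, `|a m| <= 1) -> `|wsum R w a 0 N - wsum R w a 1 N| <= eps * N%:R.
Proof.
move=> hw e0; have [X HX] := wmean_shift_invariant R w eps hw e0.
exists X => N XN a ha; rewrite !wsum_wmean -mulrBl normrM [`|N%:R|]ger0_norm //.
by rewrite ler_wpM2r // HX.
Qed.

(** Split according to the core [b]. The numbers with core [b] are [m^k * b], with
[m] up to about [(N/b)^(1/k)], and the shift by [k] becomes a shift of [Omega m] by 1. For
[b <= M] the invariance for the weight 1 applies, the remaining cores are controlled by
the tail of the convergent series. *)
Theorem kfull_shift_invariant (R : realType) (k : nat) (eps : R) : (0 < k)%N -> 0 < eps ->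
  exists X : nat, forall N, (X <= N)%N -> forall a : nat -> R, (forall m, `|a m| <= 1) ->
    root_inv R k N * `|\sum_(1 <= n < N.+1 | `[< kfull k n >])
       (a (Omega n) - a (Omega n + k)%N)| <= eps.
Proof.
move=> k0 e0; set C : R := k.+1%:R ^+ k.-1.
have C0 : 0 < C by rewrite exprn_gt0.
pose eps1 := eps / (2 * C); have e1 : 0 < eps1 by rewrite divr_gt0 // mulr_gt0.
have [X0 HX] := wsum_shift_invariant R _ eps1 (prime_invariant1 R) e1.
have [M0 HM] := core_sum_tail R k (eps / 4) k0 (divr_gt0 e0 (ltr0n _ 4)).
(* For [b <= M = N / D] the range of [m] has length more than [X0]. *)
pose D := (X0.+1 ^ k)%N; have D0 : (0 < D)%N by rewrite expn_gt0.
exists (D * M0)%N => N DN a ha; set M := (N %/ D)%N.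
have MM : (M0 <= M)%N by rewrite leq_divRL // mulnC.
have MN : (M <= N)%N by exact: leq_div.
set F := fun n => a (Omega n) - a (Omega n + k)%N.
pose S b := \sum_(1 <= n < N.+1 | `[< kfull k n >] && (kfull_core k n == b)) F n.
have core_gt0 b : is_core k b -> (0 < b)%N.
  by case/andP=> _ /eqP <-; apply: kfull_core_gt0.
have fib b : is_core k b -> root_inv R k N * `|S b| <=
    (if (b <= M)%N then eps1 else 2) * root_inv R k b.
  move=> cb; have b0 := core_gt0 _ cb.
  have [x [hx sx]] := core_fiber_sum R k b N k0 b0 cb.
  pose a' j := a (k * j + Omega b)%N.
  have -> : S b = wsum R (fun=> 1) a' 0 x - wsum R (fun=> 1) a' 1 x.
    rewrite /S sx /wsum -sumrB; apply: eq_big_nat => m /andP[m0 _].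
    rewrite /F OmegaM ?expn_gt0 ?m0 // Omega_exp // !mul1r /a'.
    by rewrite addn0 mulnDr muln1 addnAC.
  have ha' m : `|a' m| <= 1 by exact: ha.
  have xb : root_inv R k N * x%:R <= root_inv R k b.
    case: (posnP x) => [->|x0]; first by rewrite mulr0 root_inv_ge0.
    have h : (x ^ k * b <= N)%N by rewrite hx.
    rewrite -ler_pdivlMr ?ltr0n //.
    apply: (le_trans (root_inv_le R k (x ^ k * b) N _ h)).
      by rewrite muln_gt0 expn_gt0 x0.
    by rewrite root_invM root_invX root_inv_exp // mulrC.
  have key (c : R) : 0 <= c ->
     `|wsum R (fun=> 1) a' 0 x - wsum R (fun=> 1) a' 1 x| <= c * x%:R ->
     root_inv R k N * `|wsum R (fun=> 1) a' 0 x - wsum R (fun=> 1) a' 1 x|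
       <= c * root_inv R k b.
    move=> c0 h; apply: (le_trans (ler_wpM2l (root_inv_ge0 R k N) h)).
    by rewrite mulrCA ler_wpM2l.
  case: ifP => bM; apply: key => //; first exact: ltW.
    apply: HX => //; apply: ltnW; rewrite -hx -/D.
    by apply: leq_trans (leq_trunc_div N D); rewrite mulnC leq_mul2r bM orbT.
  apply: (le_trans (ler_normB _ _)); rewrite mulrDl mul1r.
  by apply: lerD; apply: wsum_norm_le => //; exact: prime_invariant1.
have split : \sum_(1 <= n < N.+1 | `[< kfull k n >]) F n =
    \sum_(0 <= b < N.+1 | is_core k b) S b.
  rewrite /S (exchange_big_dep (fun n => `[< kfull k n >])) /=; last first.
    by move=> b n _ /andP[].
  rewrite big_seq_cond [RHS]big_seq_cond; apply: eq_bigr => n /andP[].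
  rewrite mem_index_iota ltnS => /andP[n0 nN] kn.
  rewrite (eq_bigl (fun b => b == kfull_core k n)) => [|b]; last first.
    rewrite kn /= eq_sym; case: eqP => [->|]; rewrite ?andbF ?andbT //.
    exact: kfull_core_is_core.
  rewrite big_mkcond (bigD1_seq (kfull_core k n)) ?iota_uniq //=; last first.
    rewrite mem_index_iota /= ltnS; apply: leq_trans nN.
    have [m m0 {2}->] := kfull_core_decomp k n k0 n0 (asboolW kn).
    by rewrite leq_pmull // expn_gt0 m0.
  by rewrite eqxx big1 ?addr0 // => b /negPf ->.
rewrite split; apply: (le_trans (ler_wpM2l (root_inv_ge0 R k N) (ler_norm_sum _ _ _))).
rewrite mulr_sumr.
apply: (@le_trans _ _ (\sum_(0 <= b < N.+1 | is_core k b)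
   (if (b <= M)%N then eps1 else 2) * root_inv R k b)); first exact: ler_sum.
rewrite (@big_cat_nat _ _ _ M.+1) //=.
have -> : eps = eps1 * C + 2 * (eps / 4).
  by rewrite /eps1; field; rewrite gt_eqF.
apply: lerD.
  apply: (@le_trans _ _ (eps1 * \sum_(0 <= b < M.+1 | is_core k b) root_inv R k b)).
    rewrite mulr_sumr big_seq_cond [leRHS]big_seq_cond; apply: ler_sum => b.
    by rewrite mem_index_iota ltnS => /andP[/andP[_ ->]].
  by rewrite ler_wpM2l ?(ltW e1) // sum_root_inv_core_le.
apply: le_trans (ler_wpM2l _ (HM M N MM MN)) => //.
rewrite mulr_sumr big_seq_cond [leRHS]big_seq_cond; apply: ler_sum => b.
by rewrite mem_index_iota ltnS => /andP[/andP[h _] _]; rewrite leqNgt h.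
Qed.

(** * Squarefree numbers and complex values *)

Lemma squarefree_weight (R : realType) :
  prime_invariant R (fun n => (`[< squarefree n >])%:R).
Proof.
split=> [n|p m pp m0 pm]; first by case: asbool; rewrite ?ler01 ?lexx.
congr (_%:R); congr (nat_of_bool _); apply/asboolP/asboolP => h q pq.
  by apply: contra (h q pq) => /dvdn_trans; apply; rewrite dvdn_mull.
case: (eqVneq q p) => [->|qp].
  by apply: contra pm; rewrite expnS expn1 dvdn_pmul2l // prime_gt0.
apply: contra (h q pq); rewrite Gauss_dvdr // coprimeXl //.
by rewrite prime_coprime // dvdn_prime2.
Qed.

Lemma complex_norm_le (R : realType) (z : R[i]) :
  `|z| <= (`|complex.Re z| + `|complex.Im z|)%:C.
Proof.
rewrite normc_def lecR; set x := complex.Re z; set y := complex.Im z.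
have x0 := normr_ge0 x; have y0 := normr_ge0 y.
rewrite -[leRHS]ger0_norm ?addr_ge0 // -sqrtr_sqr ler_sqrt ?sqr_ge0 //.
rewrite -(real_normK (num_real x)) -(real_normK (num_real y)); nra.
Qed.

Lemma complex_Im_le (R : realType) (z : R[i]) : `|complex.Im z|%:C <= `|z|.
Proof.
rewrite normc_def lecR -sqrtr_sqr ler_sqrt ?addr_ge0 ?sqr_ge0 //.
by rewrite lerDr sqr_ge0.
Qed.

(** Real bounds uniform over all [b] with values in [-1, 1] apply to the normalized real
and imaginary parts of [a]. *)
Lemma complex_average_cvg0 (R : realType) (P : pred nat) (u v : nat -> nat)
    (c : nat -> R) (a : nat -> R[i]) :
  (exists M : R, forall m, `|a m| <= M%:C) -> (forall N, 0 <= c N) ->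
  (forall eps : R, 0 < eps -> exists X : nat, forall N, (X <= N)%N ->
     forall b : nat -> R, (forall m, `|b m| <= 1) ->
       c N * `|\sum_(1 <= n < N.+1 | P n) (b (u n) - b (v n))| <= eps) ->
  (fun N : nat => (c N)%:C * (\sum_(1 <= n < N.+1 | P n) a (u n))
     - (c N)%:C * (\sum_(1 <= n < N.+1 | P n) a (v n))) @ \oo --> (0 : R[i]^o).
Proof.
move=> [M0 hM0] c0 H; pose M := `|M0| + 1.
have Mp : 0 < M by rewrite ltr_wpDl.
have hM m : `|a m| <= M%:C.
  by apply: le_trans (hM0 m) _; rewrite lecR /M; have := ler_norm M0; lra.
set seqN := (fun N : nat => _).
have [_ crit] := @cvgr0Pnorm_lt R[i] (R[i]^o : pseudoMetricNormedZmodType R[i]) nat \oo _ seqN.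
apply: crit => eps; rewrite ltcE => /andP[/eqP im0 e0].
set e := complex.Re eps in e0.
have e1 : 0 < e / (4 * M) by rewrite divr_gt0 // mulr_gt0.
have [X HX] := H _ e1.
exists X => // N /= XN; rewrite {}/seqN.
have part (f : R[i] -> R) : {morph f : x y / x + y} -> {morph f : x / - x} -> f 0 = 0 ->
    (forall z, `|f z|%:C <= `|z|) ->
    c N * `|f (\sum_(1 <= n < N.+1 | P n) (a (u n) - a (v n)))| <= e / 4.
  move=> fD fN f0 fn; rewrite (big_morph f fD f0).
  have hb m : `|f (a m) / M| <= 1.
    rewrite normrM normfV [`|M|]gtr0_norm // ler_pdivrMr // mul1r.
    by rewrite -lecR; apply: le_trans (fn _) (hM m).
  have := HX N XN _ hb.
  have -> : \sum_(1 <= n < N.+1 | P n) (f (a (u n)) / M - f (a (v n)) / M) =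
     (\sum_(1 <= n < N.+1 | P n) f (a (u n) - a (v n))) / M.
    by rewrite mulr_suml; apply: eq_bigr => n _; rewrite fD fN mulrDl mulNr.
  rewrite normrM normfV [`|M|]gtr0_norm // mulrA ler_pdivrMr //.
  by rewrite (_ : e / (4 * M) * M = e / 4) //; field; rewrite gt_eqF.
have hRe : c N * `|complex.Re (\sum_(1 <= n < N.+1 | P n) (a (u n) - a (v n)))| <= e / 4.
  by apply: part; [case=> ? ? [] | case | | exact: normc_ge_Re].
have hIm : c N * `|complex.Im (\sum_(1 <= n < N.+1 | P n) (a (u n) - a (v n)))| <= e / 4.
  by apply: part; [case=> ? ? [] | case | | exact: complex_Im_le].
rewrite -mulrBr -sumrB normrM; set T := \sum_(_ <= _ < _ | _) _ in hRe hIm *.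
have -> : eps = e%:C by rewrite [eps]complexE; move: im0 => /= ->; rewrite mulr0 addr0.
rewrite normc_def /= expr0n addr0 sqrtr_sqr ger0_norm //.
apply: le_lt_trans (_ : (c N * (`|complex.Re T| + `|complex.Im T|))%:C < _).
  by rewrite rmorphM; apply: ler_wpM2l; [rewrite lecR | exact: complex_norm_le].
by rewrite ltcR mulrDr; lra.
Qed.

Theorem theorem1p7 (R : realType) (a : nat -> R[i])
    (ha : exists M : R, forall m : nat, `|a m| <= M%:C) :
  ((fun N : nat =>
      (N%:R)^-1 * (\sum_(1 <= n < N.+1 | `[< squarefree n >]) a (Omega n))
      - (N%:R)^-1 *
        (\sum_(1 <= n < N.+1 | `[< squarefree n >]) a (Omega n + 1)%N))
     @ \oo --> (0 : R[i]^o))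
  /\
  (forall k : nat, (2 <= k)%N ->
    (fun N : nat =>
      ((N%:R `^ (k%:R^-1))^-1)%:C *
        (\sum_(1 <= n < N.+1 | `[< kfull k n >]) a (Omega n))
      - ((N%:R `^ (k%:R^-1))^-1)%:C *
        (\sum_(1 <= n < N.+1 | `[< kfull k n >]) a (Omega n + k)%N))
     @ \oo --> (0 : R[i]^o)).
Proof.
split=> [|k k2]; last first.
  apply: (complex_average_cvg0 R _ _ _ (fun N => root_inv R k N) a ha).
    by move=> N; exact: root_inv_ge0.
  by move=> eps e0; apply: kfull_shift_invariant => //; exact: ltnW.
have E N : (N%:R : R[i])^-1 = (N%:R^-1 : R)%:C.
  by rewrite fmorphV rmorph_nat.
under eq_fun => N do rewrite E.
apply: (complex_average_cvg0 R _ _ _ (fun N => N%:R^-1) a ha) => [N|eps e0].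
  by rewrite invr_ge0.
have [X HX] := wmean_shift_invariant R _ eps (squarefree_weight R) e0.
exists X => N XN b hb; have := HX N XN b hb.
rewrite /wmean -mulrBl normrM normfV [`|N%:R|]ger0_norm // mulrC.
suff -> : wsum R (fun n => (`[< squarefree n >])%:R) b 0 N -
    wsum R (fun n => (`[< squarefree n >])%:R) b 1 N =
  \sum_(1 <= n < N.+1 | `[< squarefree n >]) (b (Omega n) - b (Omega n + 1)%N) by [].
rewrite /wsum -sumrB [RHS]big_mkcond; apply: eq_bigr => n _.
by rewrite addn0 -mulrBr; case: asbool; rewrite ?mul1r ?mul0r.
Qed.
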